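(* Let $G$ be a biconnected Eulerian graph and let $G_1,\dots,G_k$ be its 2.5-connected components (virtual edges treated as ordinary edges). Then (a) $c(G)=\sum_{i=1}^k c(G_i)-k+1$; (b) $\nu(G)=\sum_{i=1}^k \nu(G_i)-k+1$.
   Context: Graphs are finite, may have parallel edges (so a cycle may have length 2), no loops. A cycle decomposition of $G$ is a set of cycles in $G$ such that each edge lies in exactly one of them. For an Eulerian graph $H$, $c(H)$ and $\nu(H)$ are the minimum and maximum number of cycles in a cycle decomposition of $H$. Biconnected: connected and for all pairwise distinct $u,v,w$ there is a $u$-$v$ path avoiding $w$. For biconnected $H$ not a triangle, $(c,uv)\in V(H)\times E(H)$ is a vertex-edge-separator if $H-uv-c$ is disconnected; then it has exactly two components $C_u\ni u,C_v\ni v$. For $a\in\{u,v\}$ with other endpoint $b$, let $H_a=H[V(C_a)\cup\{c\}]$; if $|E(H_a)|\ge2$, the 2.5-split replaces $H$ by $H_a+ac$ and $H[V(C_b)\cup\{c\}]+ba+ac$, where the two new edges $ac$ are virtual and correspond to each other. $H$ is 2.5-connected if biconnected with no vertex-edge-separator. Applying 2.5-splits until none is possible, and then merging (gluing at corresponding virtual edges and deleting them) the resulting triangles as much as possible into cycles, gives the 2.5-connected components of $G$. *)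

(* Defs.v *)
From mathcomp Require Import all_boot.
From mathcomp Require Import boolp.
From Stdlib Require List.

Set Implicit Arguments.
Unset Strict Implicit.
Unset Printing Implicit Defensive.

(* Finite multigraphs with globally named vertices and labelled edges. *)
(* A graph is a list of vertices (nat) and a list of edges; an edge is   *)
(* (label, (x, y)).  Parallel edges are edges with distinct labels and   *)
(* the same endpoints.  Edge identity inside a graph = position in the   *)
(* edge list.  Virtual edges created by a 2.5-split get a fresh label,   *)
(* and the two corresponding virtual edges are exactly the two edges     *)
(* (in two different pieces) carrying that label.                        *)

Record mgraph := MGraph { gV : seq nat ; gE : seq (nat * (nat * nat)) }.

Definition elabel (e : nat * (nat * nat)) : nat := e.1.
Definition labels (H : mgraph) : seq nat := map elabel (gE H).

Definition wf (H : mgraph) : Prop :=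
  [/\ uniq (gV H), uniq (labels H),
      forall e, e \in gE H -> (e.2.1 \in gV H) && (e.2.2 \in gV H)
    & forall e, e \in gE H -> e.2.1 != e.2.2].

Definition adj (H : mgraph) (X L : seq nat) (x y : nat) : bool :=
  [&& x \in gV H, y \in gV H, x \notin X, y \notin X &
      has (fun e => (e.1 \notin L) && ((e.2 == (x, y)) || (e.2 == (y, x))))
          (gE H)].

Definition reach (H : mgraph) (X L : seq nat) (x y : nat) : Prop :=
  [/\ x \in gV H, x \notin X &
      exists p : seq nat, path (adj H X L) x p /\ last x p = y].

Definition connected (H : mgraph) : Prop :=
  forall u v, u \in gV H -> v \in gV H -> reach H [::] [::] u v.

Definition biconnected (H : mgraph) : Prop :=
  connected H /\
  forall u v w, u \in gV H -> v \in gV H -> w \in gV H ->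
    u != v -> u != w -> v != w -> reach H [:: w] [::] u v.

Definition degree (H : mgraph) (x : nat) : nat :=
  count (fun e => (e.2.1 == x) || (e.2.2 == x)) (gE H).

Definition eulerian (H : mgraph) : Prop :=
  forall x, x \in gV H -> ~~ odd (degree H x).

Definition ends (H : mgraph) (i : nat) : nat * nat :=
  (nth (0, (0, 0)) (gE H) i).2.

Definition is_cycle (H : mgraph) (S : {set 'I_(size (gE H))}) : Prop :=
  exists (vs : seq nat) (es : seq 'I_(size (gE H))),
    [/\ 2 <= size es, size vs = size es, uniq vs && uniq es,
        S = [set i in es] &
        forall i, i < size es ->
          let ij := (nth 0 vs i, nth 0 vs (i.+1 %% size es)) in
          (ends H (nth 0 (map val es) i) == ij) ||
          (ends H (nth 0 (map val es) i) == (ij.2, ij.1))].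

Arguments is_cycle : clear implicits.

Definition is_cycle_decomposition (H : mgraph)
    (D : {set {set 'I_(size (gE H))}}) : Prop :=
  partition D [set: 'I_(size (gE H))] /\ forall S, S \in D -> is_cycle H S.

Arguments is_cycle_decomposition : clear implicits.

(* c(H): minimum number of cycles in a cycle decomposition (the default
   value |E(H)| of the fold is an upper bound for every decomposition,
   so it is irrelevant as soon as a decomposition exists, i.e. for
   Eulerian H). *)
Definition cmin (H : mgraph) : nat :=
  \big[minn/size (gE H)]_(D : {set {set 'I_(size (gE H))}}
                            | `[< is_cycle_decomposition H D >]) #|D|.

Definition numax (H : mgraph) : nat :=
  \max_(D : {set {set 'I_(size (gE H))}}
          | `[< is_cycle_decomposition H D >]) #|D|.

Definition triangle (H : mgraph) : Prop :=
  size (undup (gV H)) = 3 /\ size (gE H) = 3 /\ is_cycle H [set: _].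

Definition cycle_graph (H : mgraph) : Prop :=
  is_cycle H [set: _] /\ size (undup (gV H)) = size (gE H).

Definition vesep (H : mgraph) (c : nat) (e : nat * (nat * nat)) : Prop :=
  [/\ biconnected H, ~ triangle H, c \in gV H, e \in gE H &
      exists x y, [/\ x \in gV H, y \in gV H, x != c, y != c &
                      ~ reach H [:: c] [:: e.1] x y]].

Definition induced (H : mgraph) (W : seq nat) : mgraph :=
  MGraph W [seq e <- gE H | (e.2.1 \in W) && (e.2.2 \in W)].

Definition add_edge (H : mgraph) (e : nat * (nat * nat)) : mgraph :=
  MGraph (gV H) (rcons (gE H) e).

Definition add_vertex (H : mgraph) (x : nat) : mgraph :=
  MGraph (x :: gV H) (gE H).

(* split_piece H c e a Ca Cb : the 2.5-split of H at the vertex-edge-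
   separator (c, e), e = (l, (u,v)), on the side a in {u,v}, with b the
   other endpoint; Ca, Cb list the vertex sets of the components C_a, C_b
   of H - uv - c.  The condition |E(H_a)| >= 2 is included. *)
Definition split_ok (H : mgraph) (c : nat) (e : nat * (nat * nat))
    (a b : nat) (Ca Cb : seq nat) : Prop :=
  [/\ vesep H c e,
      (a == e.2.1) && (b == e.2.2) || (a == e.2.2) && (b == e.2.1),
      (c != a) && (c != b),
      (forall x, (x \in Ca <-> reach H [:: c] [:: e.1] a x) /\
                 (x \in Cb <-> reach H [:: c] [:: e.1] b x)) &
      2 <= size (gE (induced H (c :: Ca)))].

Definition splittable (H : mgraph) : Prop :=
  exists c e a b Ca Cb, split_ok H c e a b Ca Cb.

Definition all_labels (s : seq mgraph) : seq nat := flatten (map labels s).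

(* one 2.5-split step on a list of pieces; f is the fresh label of the
   new pair of corresponding virtual edges ac *)
Inductive split_step : seq mgraph -> seq mgraph -> Prop :=
  | SplitStep s1 H s2 c e a b Ca Cb f :
      split_ok H c e a b Ca Cb ->
      f \notin all_labels (s1 ++ H :: s2) ->
      split_step (s1 ++ H :: s2)
        (s1 ++ add_edge (induced H (c :: Ca)) (f, (a, c))
            :: add_edge (add_edge (add_vertex (induced H (c :: Cb)) a)
                                  (e.1, (b, a))) (f, (a, c))
            :: s2).

Definition glue (P Q : mgraph) (f : nat) : mgraph :=
  MGraph (undup (gV P ++ gV Q)) [seq e <- gE P ++ gE Q | e.1 != f].

(* merging two (merged) triangles, i.e. cycle pieces, sharing a pair of
   corresponding virtual edges *)
Definition mergeable (P Q : mgraph) (f : nat) : Prop :=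
  [/\ cycle_graph P, cycle_graph Q, f \in labels P & f \in labels Q].

Inductive merge_step : seq mgraph -> seq mgraph -> Prop :=
  | MergeStep s1 P s2 Q s3 f :
      mergeable P Q f ->
      merge_step (s1 ++ P :: s2 ++ Q :: s3) (s1 ++ glue P Q f :: s2 ++ s3).

Definition can_merge (s : seq mgraph) : Prop :=
  exists s1 P s2 Q s3 f,
    s = s1 ++ P :: s2 ++ Q :: s3 /\ mergeable P Q f.

Inductive rstar (R : seq mgraph -> seq mgraph -> Prop)
    : seq mgraph -> seq mgraph -> Prop :=
  | rstar_refl s : rstar R s s
  | rstar_step s t u : R s t -> rstar R t u -> rstar R s u.

Definition two_half_components (G : mgraph) (s : seq mgraph) : Prop :=
  exists t, [/\ rstar split_step [:: G] t,
                (forall H, List.In H t -> ~ splittable H),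
                rstar merge_step t s &
                ~ can_merge s].

(* Main.v *)
Require Import Defs.
From HB Require Import structures.
From mathcomp Require Import all_boot.
From mathcomp Require Import boolp zify.

Set Implicit Arguments.
Unset Strict Implicit.
Unset Printing Implicit Defensive.

(** Cycles are exactly the minimal nonempty even edge sets (circuits), so a cycle
    decomposition is a colouring of the edge labels all of whose classes are
    circuits.  Both a 2.5-split and a merge relate a graph to a 2-sum of two graphs
    along a virtual edge [f = ac] such that [a] has degree two in one summand.
    Because of that degree, in every decomposition of the 2-sum exactly one cycle
    crosses between the summands; cutting it, respectively gluing the two cycles
    through [f], gives a correspondence of decompositions in which the numbers of
    cycles satisfy [n + 1 = n1 + n2].  Hence every step preserves
    [c(G) = sum c(G_i) - k + 1] and its analogue for [nu].

    For a merge one must know that two pieces with a common virtual edge share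
    nothing else.  This holds because the pieces can be ordered so that each one
    meets the union of its predecessors in a single virtual edge and its ends, and
    such an order can be started at any piece. *)

(** * Even edge sets and circuits *)

(** Cutting and gluing together say that the attainable numbers of cycles of a 2-sum, shifted by
    one, are exactly the sums of an attainable number for each summand. Minimum and maximum
    therefore add for the same reason, and (a) and (b) share one argument. Minimality is preferred
    to walks as the definition of a circuit because cutting and gluing then become parity
    computations; walks serve only to identify circuits with [is_cycle] and to produce a first
    decomposition. Since [cmin] and [numax] return default values when there is no decomposition,
    the invariant [good] records that every piece has one: even degrees give it for [G], and the
    2-sums transport it. A merge deletes a label from two pieces, so a third piece attached through
    that label would be cut off; [few_labels] excludes this. *)

Section Circuits.

Variable E : nat -> nat * nat.
Implicit Types (L : seq nat) (p q : pred nat).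

Definition inc (l x : nat) : bool := (x == (E l).1) || (x == (E l).2).

Definition loopless L : Prop := forall l, l \in L -> (E l).1 != (E l).2.

(** The boundary over GF(2) of the edge set [p]; written with exclusive or, it is linear in [p]
    ([par_xor]). *)
Definition par L p (x : nat) : bool :=
  \big[addb/false]_(l <- L) (p l && inc l x).

Definition even_set L p : Prop := forall x, par L p x = false.

Definition circuit L p : Prop :=
  [/\ even_set L p, has p L &
      forall q, even_set L q -> has q L ->
        {in L, forall l, q l -> p l} -> {in L, forall l, p l -> q l}].

(** Colour classes are disjoint and covering by construction, and colours can be renamed freely,
    which makes palettes easy to keep apart when two decompositions are glued. *)
Definition dec L (n : nat) : Prop :=
  exists col : nat -> nat, n = size (undup (map col L)) /\
    {in L, forall l, circuit L (fun m => col m == col l)}.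

Lemma par_ext L p q x : {in L, p =1 q} -> par L p x = par L q x.
Proof. by move=> epq; apply: eq_big_seq => l lL; rewrite epq. Qed.

Lemma even_set_ext L p q : {in L, p =1 q} -> even_set L p -> even_set L q.
Proof. by move=> epq ev x; rewrite -(par_ext _ epq). Qed.

Lemma par_cons l L p x : par (l :: L) p x = (p l && inc l x) (+) par L p x.
Proof. by rewrite /par big_cons. Qed.

Lemma par_cat L1 L2 p x : par (L1 ++ L2) p x = par L1 p x (+) par L2 p x.
Proof. by rewrite /par big_cat. Qed.

Lemma par_xor L p q x :
  par L (fun l => p l (+) q l) x = par L p x (+) par L q x.
Proof. by rewrite /par -big_split; apply: eq_bigr => l _; rewrite andb_addl. Qed.

Lemma par_noinc L p x :
  {in L, forall l, p l -> inc l x = false} -> par L p x = false.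
Proof.
move=> h; rewrite /par big1_seq // => l /andP[_ lL].
by case pl: (p l); rewrite //= h.
Qed.

Lemma par_hasN L p x : ~~ has p L -> par L p x = false.
Proof. by move/hasPn=> h; apply: par_noinc => l /h /negbTE ->. Qed.

Lemma par_supp L L' p x : uniq L -> uniq L' ->
  (forall l, p l -> (l \in L) = (l \in L')) -> par L p x = par L' p x.
Proof.
move=> uL uL' h.
have e K : par K p x = \big[addb/false]_(l <- filter p K) inc l x.
  by rewrite big_filter /par [RHS]big_mkcond; apply: eq_bigr => l _; case: (p l).
rewrite !e; apply: perm_big; apply: uniq_perm; rewrite ?filter_uniq // => l.
by rewrite !mem_filter; case pl: (p l); rewrite //= h.
Qed.

Lemma circuit_ext L p q : {in L, p =1 q} -> circuit L p -> circuit L q.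
Proof.
move=> epq [ev hp mi]; split.
- exact: even_set_ext ev.
- by rewrite -(eq_in_has epq).
- move=> r er hr srq l lL; rewrite -epq //; apply: mi => // m mL /srq.
  by rewrite epq //; apply.
Qed.

Lemma circuit_supp L L' p : uniq L -> uniq L' ->
  (forall l, p l -> l \in L) -> (forall l, p l -> l \in L') ->
  circuit L p -> circuit L' p.
Proof.
move=> uL uL' pL pL' [ev hp mi].
have same q : subpred q p -> forall x, par L q x = par L' q x.
  by move=> sqp x; apply: par_supp => // l /sqp pl; rewrite pL // pL'.
split.
- by move=> x; rewrite -same.
- by case/hasP: hp => l _ pl; apply/hasP; exists l; rewrite ?pL'.
- move=> q eq_ hq sqp l lL' pl.
  (* [q] is controlled on [L'] only, so it is cut down to [p] before it competes on [L]. *)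
  have eqp : {in L', q =1 [pred l | q l && p l]}.
    by move=> m mL' /=; case qm: (q m); rewrite //= sqp.
  have /andP[] // : [pred l | q l && p l] l.
  apply: mi => //=; last 1 [by move=> m _ /andP[] | exact: pL].
  + move=> x; rewrite same; last by move=> m /andP[].
    by rewrite -(par_ext _ eqp).
  + case/hasP: hq => m mL' qm; apply/hasP; exists m => /=.
      by apply: pL; apply: sqp.
    by rewrite qm sqp.
Qed.

Lemma circuit_perm L L' p : perm_eq L L' -> circuit L p -> circuit L' p.
Proof.
move=> pm [ev hp mi].
have same q x : par L q x = par L' q x by apply: perm_big.
split; first by move=> x; rewrite -same.
  by rewrite -(perm_has _ pm).
move=> q eq_ hq sqp l lL' pl; apply: mi => //; last by rewrite (perm_mem pm).
- by move=> x; rewrite same.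
- by rewrite (perm_has _ pm).
- by move=> m; rewrite (perm_mem pm); apply: sqp.
Qed.

Lemma dec_perm L L' n : perm_eq L L' -> dec L n -> dec L' n.
Proof.
move=> pm [col [-> h]]; exists col; split.
  by apply/perm_size/perm_undup => x; apply: perm_mem; apply: perm_map.
move=> l; rewrite -(perm_mem pm) => /h; exact: circuit_perm.
Qed.

Lemma big_addb_eq (V : seq nat) u :
  uniq V -> \big[addb/false]_(x <- V) (x == u) = (u \in V).
Proof.
elim: V => [|y V IH] /=; first by rewrite big_nil.
case/andP=> yV uV; rewrite big_cons IH // inE (eq_sym u).
by case: eqP => [<-|]; rewrite ?(negbTE yV).
Qed.

(** Summing the parities over all vertices counts every edge twice, so the total is even; only [a]
    and [c] can contribute to it. *)
Lemma handshake L p a c : loopless L -> a != c ->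
  (forall x, x != a -> x != c -> par L p x = false) -> par L p a = par L p c.
Proof.
move=> ll nac h.
(* [a] and [c] are added by hand, so that they can be extracted from the sum even if no edge of [L]
   meets them. *)
pose V := undup (a :: c :: flatten [seq [:: (E l).1; (E l).2] | l <- L]).
have uV : uniq V by apply: undup_uniq.
have mV l : l \in L -> ((E l).1 \in V) && ((E l).2 \in V).
  move=> lL; rewrite !mem_undup !inE; apply/andP; split; apply/orP; right;
  apply/orP; right; apply/flatten_mapP; exists l; rewrite // !inE eqxx ?orbT //.
have tot : \big[addb/false]_(x <- V) par L p x = false.
  rewrite /par exchange_big big1_seq // => l /andP[_ lL].
  have -> : \big[addb/false]_(x <- V) (p l && inc l x) =
            \big[addb/false]_(x <- V) ((p l && (x == (E l).1)) (+) (p l && (x == (E l).2))).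
    apply: eq_bigr => x _; rewrite /inc; case: (p l) => //=.
    by case: eqP => [->|//]; rewrite (negbTE (ll _ lL)).
  rewrite big_split; case: (p l) => /=; last by rewrite big1_eq.
  by rewrite !big_addb_eq //; case/andP: (mV _ lL) => -> ->.
have aV : a \in V by rewrite mem_undup inE eqxx.
have cV : c \in V by rewrite mem_undup !inE eqxx orbT.
move: tot; rewrite (bigD1_seq a) //= -big_filter (bigD1_seq c) /=; first last.
- by rewrite filter_uniq.
- by rewrite mem_filter eq_sym nac cV.
rewrite big1_seq ?addbF; last first.
  by move=> x; rewrite mem_filter => /andP[xc /andP[xa _]]; apply: h.
by case: (par L p a); case: (par L p c).
Qed.

End Circuits.

(** * 2-sums *)

(** Source of the shift by one: the two palettes share exactly the colour of the crossing cycle. *)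
Lemma size_undup_cat_meet1 (s1 s2 : seq nat) k : k \in s1 -> k \in s2 ->
  (forall j, j \in s1 -> j \in s2 -> j = k) ->
  size (undup (s1 ++ s2)) + 1 = size (undup s1) + size (undup s2).
Proof.
move=> k1 k2 h; rewrite undup_cat size_cat size_filter.
have := count_predC (mem s2) (undup s1).
have -> : count (mem s2) (undup s1) = 1.
  have -> : 1 = (k \in undup s1) by rewrite mem_undup k1.
  rewrite -count_uniq_mem ?undup_uniq //; apply: eq_in_count => j /=.
  by rewrite mem_undup => j1; apply/idP/eqP => [j2|->//]; apply: h.
have -> : count (predC (mem s2)) (undup s1) = count (fun x => x \notin s2) (undup s1) by [].
lia.
Qed.

(** * Circuits of a 2-sum *)

Section TwoSum.

Variables (E : nat -> nat * nat) (f a c : nat) (A B : seq nat).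
Hypothesis uAB : uniq (f :: A ++ B).
Hypothesis incf : forall x, inc E f x = (x == a) || (x == c).

Lemma twosum_uniq :
  [/\ uniq (A ++ B), uniq (f :: A), uniq (f :: B), f \notin A & f \notin B].
Proof.
move: uAB; rewrite /= cat_uniq mem_cat negb_or.
by case/and3P=> /andP[-> ->] -> /andP[-> ->].
Qed.

Lemma twosum_disjoint l : l \in A -> l \in B -> False.
Proof.
move: uAB => /= /andP[_]; rewrite cat_uniq => /and3P[_ /hasPn h _] lA lB.
by have /= := h _ lB; rewrite lA.
Qed.

(** Cutting the crossing circuit. A non-empty even subset avoiding [f] would be an even subset of
    [p] inside [A], against minimality of [p], which also has an edge in [B]. An even subset that
    contains [f] but misses an edge leaves such a set as its complement in [p1]. *)
Lemma circuit_half p p1 : circuit E (A ++ B) p -> has p B ->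
  even_set E (f :: A) p1 -> p1 f -> {in A, p1 =1 p} -> circuit E (f :: A) p1.
Proof.
have [uL ufA ufB fA fB] := twosum_uniq.
move=> [ev hp mi] /hasP[m mB pm] ev1 p1f e1.
have key q : even_set E (f :: A) q -> q f = false ->
    {in A, forall l, q l -> p l} -> has q A -> False.
  move=> evq qf qp /hasP[l lA ql].
  have /andP[] : [pred l | q l && (l \in A)] m.
    apply: mi => //=.
    - move=> x; rewrite -[RHS](evq x) (@par_supp _ _ (f :: A)) //.
        by apply: par_ext => k /=; rewrite in_cons => /predU1P[->|->]; rewrite ?qf ?andbT.
      by move=> k /= /andP[_ kA]; rewrite mem_cat inE kA orbT.
    - by apply/hasP; exists l; rewrite ?mem_cat /= ?lA ?ql.
    - by move=> k _ /andP[qk kA]; apply: qp.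
    - by rewrite mem_cat mB orbT.
  by move=> _ mA; apply: (twosum_disjoint mA mB).
split=> //; first by rewrite /= p1f.
move=> q evq hq sq; case qf: (q f); last first.
  case: (key q) => //.
    by move=> l lA ql; rewrite -e1 //; apply: sq => //; rewrite inE lA orbT.
  by move: hq; rewrite /= qf.
move=> l; rewrite in_cons => /predU1P[->//|lA] pl.
case ql: (q l) => //; case: (key (fun k => p1 k (+) q k)).
- by move=> x; rewrite par_xor ev1 evq.
- by rewrite p1f qf.
- move=> k kA; rewrite -e1 //; case p1k: (p1 k) => //= qk.
  by rewrite -p1k; apply: sq; rewrite // inE kA orbT.
- by apply/hasP; exists l => //=; rewrite pl ql.
Qed.

(** An even subset [q] of [p] has the boundary of [t] copies of [f] on both sides. One edge of [q]
    on either side forces [t], by minimality of that half; and [t] forces all of [p] on both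
    sides. *)
Lemma circuit_join p p1 p2 :
  (forall q, even_set E (A ++ B) q -> exists t : bool,
     forall x, par E A q x = t && inc E f x /\ par E B q x = t && inc E f x) ->
  circuit E (f :: A) p1 -> circuit E (f :: B) p2 -> p1 f -> p2 f ->
  {in A, p =1 p1} -> {in B, p =1 p2} -> circuit E (A ++ B) p.
Proof.
have [uL ufA ufB fA fB] := twosum_uniq.
move=> spl [ev1 hp1 mi1] [ev2 hp2 mi2] p1f p2f e1 e2.
have parA x : par E A p x = inc E f x.
  have := ev1 x; rewrite par_cons p1f (par_ext _ _ e1) /=.
  by case: (inc E f x); case: par.
have parB x : par E B p x = inc E f x.
  have := ev2 x; rewrite par_cons p2f (par_ext _ _ e2) /=.
  by case: (inc E f x); case: par.
split.
- by move=> x; rewrite par_cat parA parB addbb.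
- rewrite has_cat; case hA: (has p A) => //.
  have := parA a; rewrite par_hasN ?hA // incf eqxx //.
move=> q evq; have [t ht] := spl _ evq.
have key (C : seq nat) (pC : pred nat) : f \notin C -> (forall x, par E C q x = t && inc E f x) ->
     (forall q, even_set E (f :: C) q -> has q (f :: C) ->
      {in f :: C, forall l : nat, q l -> pC l} ->
     {in f :: C, forall l : nat, pC l -> q l}) -> pC f ->
     {in C, p =1 pC} -> {in C, forall l, q l -> p l} ->
     (t -> {in C, forall l, p l -> q l}) /\ (has q C -> t).
  move=> fC parC mi pCf eC sub.
  (* Adding [f] exactly when [t] holds cancels the boundary of [q] on [C]. *)
  pose q1 := [pred l | if l == f then t else q l].
  have q1C : {in C, q1 =1 q}.
    by move=> l lC /=; case: eqP lC => [->|//]; rewrite (negbTE fC).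
  have evq1 : even_set E (f :: C) q1.
    move=> x; rewrite par_cons (par_ext _ _ q1C) /= eqxx parC.
    by case: (t && _).
  have sub1 : {in f :: C, forall l, q1 l -> pC l}.
    move=> l; rewrite in_cons => /predU1P[->//|lC].
    by rewrite q1C // -eC //; apply: sub.
  split.
    move=> tt l lC; rewrite eC // -q1C //; apply: mi => //=.
      by rewrite eqxx tt.
    by rewrite inE lC orbT.
  move=> hq; have := mi q1 evq1 _ sub1 f; rewrite inE eqxx /= => H.
  have := H _ isT pCf; rewrite eqxx; apply.
  by apply/orP; right; rewrite (eq_in_has q1C).
move=> hq sub.
have [||a1 a2] := key A p1 fA _ mi1 p1f e1; first by move=> x; case: (ht x).
  by move=> l lA; apply: sub; rewrite mem_cat lA.
have [||b1 b2] := key B p2 fB _ mi2 p2f e2; first by move=> x; case: (ht x).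
  by move=> l lB; apply: sub; rewrite mem_cat lB orbT.
have tt : t by move: hq; rewrite has_cat => /orP[/a2|/b2].
by move=> l; rewrite mem_cat => /orP[]; [apply: a1 | apply: b1].
Qed.

(** The part of [p] in [A] is itself non-empty and even, so by minimality it is all of [p]; the
    circuit never crosses. *)
Lemma circuit_side p : circuit E (A ++ B) p -> even_set E A p -> has p A ->
  ~~ has p B /\ forall p1, p1 f = false -> {in A, p1 =1 p} -> circuit E (f :: A) p1.
Proof.
have [uL ufA ufB fA fB] := twosum_uniq.
move=> cp evA hA; have [ev hp mi] := cp.
have pA : {in A ++ B, forall l, p l -> p l && (l \in A)}.
  apply: (mi [pred l | p l && (l \in A)]).
  - move=> x; rewrite par_cat (@par_ext _ _ _ p); last by move=> l lA /=; rewrite lA andbT.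
    rewrite evA par_hasN //; apply/hasPn => l lB /=; apply/negP => /andP[_ lA].
    exact: twosum_disjoint lA lB.
  - by case/hasP: hA => l lA pl; apply/hasP; exists l; rewrite ?mem_cat /= ?lA ?pl.
  - by move=> l _ /andP[].
split.
  apply/hasPn => l lB; apply/negP => pl.
  have lL : l \in A ++ B by rewrite mem_cat lB orbT.
  have /andP[_ lA] := pA _ lL pl.
  exact: twosum_disjoint lA lB.
move=> p1 p1f e1.
apply: (@circuit_ext _ _ [pred l | p l && (l \in A)]).
  move=> l; rewrite in_cons => /predU1P[->|lA] /=; first by rewrite (negbTE fA) andbF p1f.
  by rewrite e1 // -[RHS]andbT; congr (_ && _).
apply: (@circuit_supp _ (A ++ B)) => //.
- by move=> l /andP[_ lA]; rewrite mem_cat lA.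
- by move=> l /andP[_ lA]; rewrite inE lA orbT.
apply: circuit_ext cp => l lL /=; apply/idP/andP => [pl|[]//].
by apply/andP; apply: pA.
Qed.

End TwoSum.

(** * Decompositions of a 2-sum *)

Section TwoSumDec.

Variables (E : nat -> nat * nat) (f a c e : nat) (A B : seq nat).
Hypothesis uAB : uniq (f :: A ++ B).
Hypothesis llAB : loopless E (A ++ B).
Hypothesis nac : a != c.
Hypothesis incf : forall x, inc E f x = (x == a) || (x == c).
Hypothesis sep : forall x, x != a -> x != c ->
  {in A, forall l, inc E l x = false} \/ {in B, forall l, inc E l x = false}.
Hypothesis eB : e \in B.
Hypothesis deg2 : {in B, forall l, inc E l a = (l == e)}.

Lemma twosum_par_deg2 p : par E B p a = p e.
Proof.
have [_ _ /andP[_ uB] _ _] := twosum_uniq uAB.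
rewrite /par (eq_big_seq (fun l => p e && (l == e))); last first.
  by move=> l lB; rewrite deg2 //; case: eqP => [->//|]; rewrite !andbF.
case: (p e); rewrite /= ?big1_eq //.
by rewrite big_addb_eq.
Qed.

(* The degree-two vertex [a] forces every even set to cross the 2-sum exactly
   when it contains the edge [e]. *)
Lemma twosum_par p : even_set E (A ++ B) p ->
  forall x, par E A p x = p e && inc E f x /\ par E B p x = p e && inc E f x.
Proof.
move=> ev.
have eAB x : par E A p x = par E B p x.
  by have := ev x; rewrite par_cat; do 2!case: par.
have out x : x != a -> x != c -> par E B p x = false.
  move=> xa xc; case: (sep xa xc) => h; last by apply: par_noinc => l lB _; apply: h.
  by rewrite -eAB; apply: par_noinc => l lA _; apply: h.
have llB : loopless E B by move=> l lB; apply: llAB; rewrite mem_cat lB orbT.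
have hc := handshake llB nac out; rewrite twosum_par_deg2 in hc.
suff h x : par E B p x = p e && inc E f x by move=> x; rewrite eAB h.
rewrite incf; case: (eqVneq x a) => [->|xa] /=; first by rewrite twosum_par_deg2 andbT.
case: (eqVneq x c) => [->|xc] /=; first by rewrite -hc andbT.
by rewrite out // andbF.
Qed.

(** By [twosum_par] the class of [e] is the one that crosses: it is cut by [circuit_half]. All other
    classes are even on each side separately and stay on one side by [circuit_side]. *)
Lemma dec_twosum_split n : dec E (A ++ B) n -> exists n1 n2,
  [/\ dec E (f :: A) n1, dec E (f :: B) n2 & n + 1 = n1 + n2].
Proof.
have [uL ufA ufB fA fB] := twosum_uniq uAB.
move=> [col [-> h]].
(* [f] closes both halves of the crossing cycle, so it takes the colour of [e]. *)
pose col' l := if l == f then col e else col l.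
have col'A : {in A, col' =1 col}.
  by move=> l lA; rewrite /col'; case: eqP lA fA => [-> ->|].
have col'B : {in B, col' =1 col}.
  by move=> l lB; rewrite /col'; case: eqP lB fB => [-> ->|].
have col'f : col' f = col e by rewrite /col' eqxx.
have eL : e \in A ++ B by rewrite mem_cat eB orbT.
have parE := twosum_par (let: And3 ev _ _ := h _ eL in ev).
rewrite eqxx /= in parE.
have hasA : has (fun m => col m == col e) A.
  apply/negPn/negP => /par_hasN hN; have [] := parE a.
  by rewrite hN incf eqxx.
have hasB : has (fun m => col m == col e) B by apply/hasP; exists e => /=.
have other l : l \in A ++ B -> col l != col e -> forall x,
    par E A (fun m => col m == col l) x = false /\ par E B (fun m => col m == col l) x = false.
  move=> lL ne x; have [ev _ _] := h _ lL; have := twosum_par ev x.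
  by rewrite eq_sym (negbTE ne).
(* [circuit_half] and [circuit_side] are symmetric in the two sides, so they are reused with [A] and
   [B] exchanged. *)
have uBA : uniq (f :: B ++ A).
  by rewrite (perm_uniq (s2 := f :: A ++ B)) // perm_cons perm_catC.
have pBA : perm_eq (A ++ B) (B ++ A) by rewrite perm_catC.
exists (size (undup (map col' (f :: A)))), (size (undup (map col' (f :: B)))).
split.
- exists col'; split=> // l lfA.
  case: (eqVneq (col' l) (col e)) => [cl|ncl].
    apply: (circuit_half uAB (h _ eL)) => //.
    + move=> x; rewrite par_cons col'f cl eqxx /=.
      rewrite (@par_ext _ _ _ (fun m => col m == col e)); last by move=> m mA; rewrite /= col'A.
      by have [-> _] := parE x; rewrite addbb.
    + by rewrite col'f cl.
    + by move=> m mA; rewrite cl col'A.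
  have lA : l \in A.
    by move: lfA ncl; rewrite in_cons => /predU1P[->|//]; rewrite col'f eqxx.
  rewrite col'A // in ncl *.
  have lL : l \in A ++ B by rewrite mem_cat lA.
  have [||_] := circuit_side uAB (h _ lL).
  + by move=> x; case: (other l lL ncl x).
  + by apply/hasP; exists l => //=.
  apply; first by rewrite col'f eq_sym (negbTE ncl).
  by move=> m mA; rewrite col'A.
- exists col'; split=> // l lfB.
  case: (eqVneq (col' l) (col e)) => [cl|ncl].
    apply: (circuit_half uBA (circuit_perm pBA (h _ eL))) => //.
    + move=> x; rewrite par_cons col'f cl eqxx /=.
      rewrite (@par_ext _ _ _ (fun m => col m == col e)); last by move=> m mA; rewrite /= col'B.
      by have [_ ->] := parE x; rewrite addbb.
    + by rewrite col'f cl.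
    + by move=> m mA; rewrite cl col'B.
  have lB : l \in B.
    by move: lfB ncl; rewrite in_cons => /predU1P[->|//]; rewrite col'f eqxx.
  rewrite col'B // in ncl *.
  have lL : l \in A ++ B by rewrite mem_cat lB orbT.
  have [||_] := circuit_side uBA (circuit_perm pBA (h _ lL)).
  + by move=> x; case: (other l lL ncl x).
  + by apply/hasP; exists l => //=.
  apply; first by rewrite col'f eq_sym (negbTE ncl).
  by move=> m mA; rewrite col'B.
have keA : col e \in map col A.
  by case/hasP: hasA => m mA /eqP <-; apply: map_f.
rewrite /= col'f.
have -> : map col' A = map col A by apply/eq_in_map.
rewrite keA.
have -> : map col' B = map col B by apply/eq_in_map.
rewrite map_f // map_cat; apply: size_undup_cat_meet1 keA (map_f _ eB) _.
(* A second common colour would be a class that is even on [A], meets [A], and still meets [B]. *)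
move=> j /mapP[l lA ->] /mapP[m mB elm].
apply/eqP/negPn/negP => ncl.
have lL : l \in A ++ B by rewrite mem_cat lA.
have [||] := circuit_side uAB (h _ lL).
+ by move=> x; case: (other l lL ncl x).
+ by apply/hasP; exists l => //=.
by move/hasPn => /(_ m mB) /=; rewrite elm eqxx.
Qed.

Lemma dec_recolour (L : seq nat) (col g : nat -> nat) : injective g ->
  {in L, forall l, circuit E L (fun m => col m == col l)} ->
  size (undup (map (g \o col) L)) = size (undup (map col L)) /\
  {in L, forall l, circuit E L (fun m => (g \o col) m == (g \o col) l)}.
Proof.
move=> gI h; split; first by rewrite map_comp undup_map_inj // size_map.
move=> l lL; apply: circuit_ext (h _ lL) => m _ /=.
by rewrite (inj_eq gI).
Qed.

Lemma dec_twosum_join n1 n2 : dec E (f :: A) n1 -> dec E (f :: B) n2 ->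
  exists2 n, dec E (A ++ B) n & n + 1 = n1 + n2.
Proof.
have [uL ufA ufB fA fB] := twosum_uniq uAB.
move=> [c1 [-> h1]] [c2 [-> h2]].
(* The class of [f] receives colour 0 on both sides; the remaining colours become odd on one side
   and positive even on the other, so 0 is the only possible common colour. *)
pose g1 k := if k == c1 f then 0 else k.*2.+1.
pose g2 k := if k == c2 f then 0 else k.*2.+2.
have g1I : injective g1 by move=> i j; rewrite /g1; do 2!case: eqP; lia.
have g2I : injective g2 by move=> i j; rewrite /g2; do 2!case: eqP; lia.
have [<- {}h1] := dec_recolour g1I h1.
have [<- {}h2] := dec_recolour g2I h2.
set d1 := g1 \o c1 in h1 *; set d2 := g2 \o c2 in h2 *.
have d1f : d1 f = 0 by rewrite /d1 /g1 /= eqxx.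
have d2f : d2 f = 0 by rewrite /d2 /g2 /= eqxx.
have d12 i j : d1 i = d2 j -> d1 i = 0.
  by rewrite /d1 /d2 /= /g1 /g2; do 2!case: eqP => //; lia.
pose d l := if l \in A then d1 l else d2 l.
have dA : {in A, d =1 d1} by move=> l lA; rewrite /d lA.
have dB : {in B, d =1 d2}.
  by move=> l lB; rewrite /d; case: ifP => // lA; case: (twosum_disjoint uAB lA lB).
(* Colour 0 also occurs away from [f]: otherwise [f] alone would be a circuit, although its degree
   at [a] is odd. Dropping [f] thus loses no colour. *)
have zero (C : seq nat) (dC : nat -> nat) : f \notin C -> dC f = 0 ->
    {in f :: C, forall l, circuit E (f :: C) (fun m => dC m == dC l)} ->
    0 \in map dC C.
  move=> fC df /(_ f (mem_head _ _)) [ev _ _].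
  have := ev a; rewrite par_cons eqxx incf eqxx /=.
  case hC : (has (fun m => dC m == dC f) C); last by rewrite par_hasN ?hC.
  by case/hasP: hC => m mC /eqP; rewrite df => <- _; apply: map_f.
have zA := zero A d1 fA d1f h1; have zB := zero B d2 fB d2f h2.
exists (size (undup (map d (A ++ B)))).
  exists d; split=> // l lL.
  case: (eqVneq (d l) 0) => [dl0|dl0].
    apply: (circuit_join uAB incf _ (h1 _ (mem_head _ _)) (h2 _ (mem_head _ _))) => //.
    - by move=> q /twosum_par hq; exists (q e).
    - by move=> m mA; rewrite /= dl0 dA // d1f.
    - by move=> m mB; rewrite /= dl0 dB // d2f.
  move: (lL); rewrite mem_cat => /orP[lA|lB].
    apply: (@circuit_ext _ _ [pred m | (m \in A) && (d1 m == d1 l)]).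
      move=> m; rewrite mem_cat => mAB /=; case mA: (m \in A) => /=; first by rewrite !dA.
      rewrite mA in mAB; rewrite (dA l lA) (dB m mAB); apply/esym/negbTE/eqP => dml.
      by case/eqP: dl0; rewrite dA //; apply: (@d12 _ m).
    apply: (@circuit_supp _ (f :: A)) => //.
    - by move=> m /andP[mA _]; rewrite inE mA orbT.
    - by move=> m /andP[mA _]; rewrite mem_cat mA.
    apply: circuit_ext (h1 l _); last by rewrite inE lA orbT.
    move=> m; rewrite in_cons => /predU1P[->|mA] /=; last by rewrite mA.
    by rewrite (negbTE fA) d1f -dA // eq_sym (negbTE dl0).
  apply: (@circuit_ext _ _ [pred m | (m \in B) && (d2 m == d2 l)]).
    move=> m; rewrite mem_cat => mAB /=; case mB: (m \in B) => /=; first by rewrite !dB.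
    rewrite mB orbF in mAB; rewrite (dB l lB) (dA m mAB); apply/esym/negbTE/eqP => dml.
    by case/eqP: dl0; rewrite dB // -dml; apply: (@d12 _ l).
  apply: (@circuit_supp _ (f :: B)) => //.
  - by move=> m /andP[mB _]; rewrite inE mB orbT.
  - by move=> m /andP[mB _]; rewrite mem_cat mB orbT.
  apply: circuit_ext (h2 l _); last by rewrite inE lB orbT.
  move=> m; rewrite in_cons => /predU1P[->|mB] /=; last by rewrite mB.
  by rewrite (negbTE fB) d2f -dB // eq_sym (negbTE dl0).
rewrite /= d1f d2f zA zB map_cat.
have -> : map d A = map d1 A by apply/eq_in_map.
have -> : map d B = map d2 B by apply/eq_in_map.
apply: size_undup_cat_meet1 zA zB _.
by move=> j /mapP[l lA ->] /mapP[m mB] /d12.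
Qed.

End TwoSumDec.

(** * Circuits are cycles *)

Section Cycles.

Variable E : nat -> nat * nat.
Implicit Types (vs ls L : seq nat) (p q : pred nat).

Definition cyclic_walk (vs ls : seq nat) : Prop :=
  [/\ 2 <= size ls, size vs = size ls, uniq vs, uniq ls &
      forall i, i < size ls -> forall x,
        inc E (nth 0 ls i) x =
        (x == nth 0 vs i) || (x == nth 0 vs (i.+1 %% size ls))].

Definition open_walk (vs ls : seq nat) : Prop :=
  [/\ size vs = (size ls).+1, uniq vs, uniq ls &
      forall i, i < size ls -> forall x,
        inc E (nth 0 ls i) x = (x == nth 0 vs i) || (x == nth 0 vs i.+1)].

(** Each vertex of the walk meets exactly two of its edges, the arriving and the leaving one; these
    differ because the length is at least two. *)
Lemma cyclic_walk_par vs ls L p : cyclic_walk vs ls -> uniq L ->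
  {subset ls <= L} -> {in L, forall l, p l -> l \in ls} ->
  (forall i, i < size ls ->
     par E L p (nth 0 vs (i.+1 %% size ls)) =
     p (nth 0 ls i) (+) p (nth 0 ls (i.+1 %% size ls))) /\
  (forall x, x \notin vs -> par E L p x = false).
Proof.
move=> [n2 sv uv ul h] uL sl pl; set n := size ls in n2 sv h *.
have red x : par E L p x = par E ls p x.
  rewrite (@par_ext _ _ _ [pred l | p l && (l \in ls)]); last first.
    by move=> l lL /=; case q: (p l); rewrite //= pl.
  rewrite (@par_supp _ _ ls) //; last by move=> l /= /andP[_ l1]; rewrite l1 sl.
  by apply: par_ext => l l1 /=; rewrite l1 andbT.
have modn1 i : i < n -> i.+1 %% n < n by move=> _; rewrite ltn_mod; lia.
split=> [i ilt|x xvs]; last first.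
  rewrite red; apply: par_noinc => l /(nthP 0)[i il <-] _.
  rewrite h //; apply/negbTE; rewrite negb_or; apply/andP; split.
    by apply: contraNneq xvs => ->; rewrite mem_nth // sv.
  by apply: contraNneq xvs => ->; rewrite mem_nth // sv modn1.
rewrite red /par (big_nth 0) big_mkord.
rewrite -/n; set j := i.+1 %% n.
have jn : j < n by apply: modn1.
have nij : i != j.
  rewrite /j; case: (ltngtP i.+1 n) => c; try lia; first by rewrite modn_small //; lia.
  by rewrite c modnn; lia.
rewrite (bigD1 (Ordinal ilt)) //= (bigD1 (Ordinal jn)) /=; last first.
  by rewrite eq_sym -val_eqE.
rewrite big1 ?addbF; first by rewrite !h // eqxx ?orbT !andbT.
move=> k /andP[ki kj]; rewrite h // !nth_uniq ?sv ?modn1 //.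
have -> : (j == k :> nat) = false by rewrite eq_sym; apply/negbTE.
(* The cyclic successor is injective, so edge [k] does not arrive at vertex [j]. *)
have -> : (j == k.+1 %% n) = false; last by rewrite andbF.
apply/negbTE; apply: contra ki => /eqP; rewrite /j -val_eqE /=.
have := ltn_ord k; rewrite -/n => kn.
case: (ltngtP i.+1 n) => c1; case: (ltngtP k.+1 n) => c2;
  rewrite ?c1 ?c2 ?modnn ?(modn_small c1) ?(modn_small c2) //; try lia.
Qed.

(** Evenness passes membership in a subset [q] from each edge to the next, so [q] contains all of
    the walk or none of it. *)
Lemma cyclic_walk_circuit vs ls L : cyclic_walk vs ls -> uniq L ->
  {subset ls <= L} -> circuit E L (mem ls).
Proof.
move=> cw uL sl; have [n2 sv uv ul h] := cw.
have modn1 i : i < size ls -> i.+1 %% size ls < size ls.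
  by move=> _; rewrite ltn_mod; lia.
split.
- move=> x; have [e1 e2] := cyclic_walk_par cw uL sl (fun l _ pl => pl).
  case xvs: (x \in vs); last by apply: e2; rewrite xvs.
  case/(nthP 0): xvs => i; rewrite sv => ilt <-.
  have [k kn <-] : exists2 k, k < size ls & k.+1 %% size ls = i.
    case: i ilt => [|i] ilt; last by exists i; [lia | rewrite modn_small].
    by exists (size ls).-1; [lia | rewrite prednK ?modnn //; lia].
  by rewrite e1 //= !mem_nth // modn1.
- case: ls n2 sl {cw sv ul h modn1} => [|l ls] //= _ sl.
  by apply/hasP; exists l; rewrite ?sl //= mem_head.
move=> q evq /hasP[l0 l0L ql0] sub.
have [e1 _] := cyclic_walk_par cw uL sl sub.
have step i : i < size ls -> q (nth 0 ls i) = q (nth 0 ls (i.+1 %% size ls)).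
  by move=> /e1; rewrite evq; do 2!case: (q _).
have all0 i : i < size ls -> q (nth 0 ls i) = q (nth 0 ls 0).
  elim: i => [//|i IH] ilt; rewrite -IH; last by lia.
  by rewrite (step i) ?modn_small //; lia.
have /(nthP 0)[k kn ek] := sub _ l0L ql0.
move=> l lL /(nthP 0)[i ilt <-].
by rewrite all0 // -(all0 k) // ek.
Qed.

Lemma inc_other l x : inc E l x -> (E l).1 != (E l).2 ->
  exists2 y, y != x & forall z, inc E l z = (z == x) || (z == y).
Proof.
rewrite /inc => /orP[] /eqP -> ne; [exists (E l).2 | exists (E l).1] => //.
  by rewrite eq_sym.
by move=> z; rewrite orbC.
Qed.

(** The chord [l] closes the initial segment that ends at [y]. No edge of [ls] but the first meets
    the initial vertex, so [l] is new; it may be parallel to the first edge, which gives a cycle of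
    length two. *)
Lemma open_walk_close vs ls l y : open_walk vs ls -> 0 < size ls ->
  y \in vs -> y != nth 0 vs 0 -> l != nth 0 ls 0 ->
  (forall z, inc E l z = (z == nth 0 vs 0) || (z == y)) ->
  exists vs' ls', cyclic_walk vs' ls' /\ {subset ls' <= l :: ls}.
Proof.
move=> [sv uv ul h] s0 yvs ny0 nl0 il.
case/(nthP 0): yvs ny0 il => j; rewrite sv => jn <- ny0 il.
have j0 : 0 < j by case: j ny0 {jn il} => //; rewrite eqxx.
have nlt i : i < size ls -> l != nth 0 ls i.
  move=> ilt; apply: contra nl0 => /eqP el.
  case: i ilt el => [//|i] ilt el; first by rewrite el.
  have : inc E l (nth 0 vs 0) by rewrite il eqxx.
  by rewrite el h // !nth_uniq ?sv //; lia.
exists (take j.+1 vs), (rcons (take j ls) l); split; last first.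
  move=> k; rewrite mem_rcons !inE => /orP[->//|/mem_take ->]; exact: orbT.
have sj : size (take j ls) = j by rewrite size_takel.
split.
- by rewrite size_rcons sj.
- by rewrite size_rcons sj size_takel // sv.
- exact: take_uniq.
- rewrite rcons_uniq take_uniq // andbT; apply/(nthP 0) => -[i].
  rewrite sj => ij; rewrite nth_take // => el.
  by have := nlt i; rewrite el eqxx => /(_ _)/negP; apply=> //; lia.
rewrite size_rcons sj => i ij x; rewrite nth_rcons sj.
case: (ltngtP i j) => [ilt|jlt|->]; last 2 first.
- by lia.
- by rewrite il modnn !nth_take // orbC.
rewrite modn_small // !nth_take //.
by apply: h; lia.
Qed.

(* A walk on distinct vertices can always be prolonged at its first vertex,
   by evenness; it is bounded, so it eventually closes up. *)
Lemma even_set_cyclic_walk L p : uniq L -> loopless E L -> even_set E L p ->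
  has p L -> exists vs ls, cyclic_walk vs ls /\ {in ls, forall l, (l \in L) && p l}.
Proof.
move=> uL ll ev /hasP[l0 l0L pl0].
pose good ls := {in ls, forall l, (l \in L) && p l}.
suff main m vs ls : open_walk vs ls -> 0 < size ls -> good ls ->
    size L < size ls + m ->
    exists vs ls, cyclic_walk vs ls /\ {in ls, forall l, (l \in L) && p l}.
  apply: (main (size L).+1 [:: (E l0).1; (E l0).2] [:: l0]) => //.
  - split=> //=; first by rewrite inE (ll _ l0L).
    by case.
  - by move=> l; rewrite inE => /eqP ->; rewrite l0L.
elim: m vs ls => [|m IH] vs ls ow s0 gd sm.
  have [_ _ ul _] := ow.
  have : size ls <= size L by apply: uniq_leq_size => // l /gd /andP[].
  by lia.
have [sv uv ul h] := ow.
set x := nth 0 vs 0; set l := nth 0 ls 0.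
have lls : l \in ls by apply: mem_nth.
have /andP[lL pl] := gd _ lls.
have lx : inc E l x by rewrite h // eqxx.
have [l' [l'L pl' nl' l'x]] : exists l', [/\ l' \in L, p l', l' != l & inc E l' x].
  have := ev x; rewrite /par (bigD1_seq l) //= pl lx.
  case ex: (has (fun k => [&& k != l, p k & inc E k x]) L).
    by case/hasP: ex => k kL /and3P[]; exists k.
  rewrite big1_seq // => k /andP[nk kL].
  by move/hasPn: (negbT ex) => /(_ k kL); rewrite nk /=; case: (_ && _).
have [y nyx hy] := inc_other l'x (ll _ l'L).
case yvs: (y \in vs).
  have [vs' [ls' [cw sub]]] := open_walk_close ow s0 yvs nyx nl' hy.
  exists vs', ls'; split=> // k /sub; rewrite in_cons => /predU1P[->|/gd//].
  by rewrite l'L.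
apply: (IH (y :: vs) (l' :: ls)) => //=; last by lia.
- split=> //=; rewrite ?sv ?yvs //.
  + rewrite ul andbT; apply/(nthP 0) => -[i ilt el].
    have yi : inc E l' y by rewrite hy eqxx orbT.
    move: yi; rewrite -el h // => yi.
    suff : y \in vs by rewrite yvs.
    by case/orP: yi => /eqP ->; apply: mem_nth; rewrite sv // ltnW.
  + case=> [_ z|i ilt z] /=; last by apply: h.
    by rewrite hy orbC.
- by move=> k; rewrite in_cons => /predU1P[->|/gd//]; rewrite l'L.
Qed.

(** A non-empty even set contains a cyclic walk, and minimality makes the walk exhaust a circuit. *)
Lemma circuit_cyclic_walk L p : uniq L -> loopless E L -> circuit E L p ->
  exists vs ls, [/\ cyclic_walk vs ls, {subset ls <= L} &
                   {in L, forall l, p l = (l \in ls)}].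
Proof.
move=> uL ll [ev hp mi].
have [vs [ls [cw gd]]] := even_set_cyclic_walk uL ll ev hp.
have sl : {subset ls <= L} by move=> l /gd /andP[].
exists vs, ls; split=> // l lL.
have [ev' hl _] := cyclic_walk_circuit cw uL sl.
apply/idP/idP => [|/gd/andP[]//]; apply: mi => //.
by move=> k _ /gd /andP[].
Qed.

(** Cyclic walks are peeled off one by one: removing an even subset keeps the rest even. The
    induction is on the number of edges that remain in [p]. *)
Lemma even_dec L : uniq L -> loopless E L -> even_set E L predT ->
  exists n, dec E L n.
Proof.
move=> uL ll ev.
suff main m p : count p L <= m -> even_set E L p -> exists col : nat -> nat,
    {in L, forall l, p l -> circuit E L (fun k => p k && (col k == col l))}.
  have [col h] := main _ predT (leqnn _) ev.
  by exists (size (undup (map col L))), col; split=> // l lL; apply: h.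
elim: m p => [|m IH] p cm evp.
  exists id => l lL pl; have : has p L by apply/hasP; exists l.
  by rewrite has_count; lia.
case hp: (has p L); last first.
  by exists id => l lL pl; move/hasPn: (negbT hp) => /(_ l lL); rewrite pl.
have [vs [ls [cw gd]]] := even_set_cyclic_walk uL ll evp hp.
have sl : {subset ls <= L} by move=> l /gd /andP[].
have ci := cyclic_walk_circuit cw uL sl; have [ev' hl _] := ci.
(* As [ls] lies inside [p], the set difference is a symmetric difference, to which [par_xor]
   applies. *)
have eqx : {in L, (fun k => p k (+) (k \in ls)) =1 [pred k | p k && (k \notin ls)]}.
  move=> k kL /=; case kl: (k \in ls); last by rewrite addbF andbT.
  by have /andP[_ ->] := gd _ kl.
have [|x|col hc] := IH [pred k | p k && (k \notin ls)].
- have : count p L = count [pred k | p k && (k \in ls)] L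
                     + count [pred k | p k && (k \notin ls)] L.
    rewrite -count_predUI [X in _ + X](@eq_count _ _ pred0) ?count_pred0 ?addn0.
      by apply: eq_count => k /=; case: (p k); case: (k \in ls).
    by move=> k /=; case: (p k); case: (k \in ls).
  have : 0 < count [pred k | p k && (k \in ls)] L.
    rewrite -has_count; case/hasP: hl => k kL kl; apply/hasP; exists k => //=.
    by have /andP[_ ->] := gd _ kl.
  by lia.
- by rewrite -(par_ext _ _ eqx) par_xor evp ev'.
(* Shifting the recursive colours frees 0 for the walk just removed. *)
exists (fun k => if k \in ls then 0 else (col k).+1) => l lL pl.
case ll_: (l \in ls).
  apply: circuit_ext ci => k kL /=.
  by case kl: (k \in ls); rewrite ?andbF //; have /andP[_ ->] := gd _ kl.
apply: circuit_ext (hc l lL _); last by rewrite /= pl ll_.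
by move=> k kL /=; case: (k \in ls); rewrite ?andbF ?andbT //.
Qed.

End Cycles.

(* [E] assigns ends to labels globally, so that all pieces share one incidence
   structure.  Uniqueness of [gV H] is not required: the vertex lists [Ca] and [Cb]
   of a split may contain repetitions. *)
Definition realises (E : nat -> nat * nat) (H : mgraph) : Prop :=
  [/\ uniq (labels H), loopless E (labels H),
      (forall e, e \in gE H -> forall x,
         inc E e.1 x = (x == e.2.1) || (x == e.2.2)) &
      (forall l x, l \in labels H -> inc E l x -> x \in gV H)].

Lemma same_pair (u v x y : nat) :
  (forall z, (z == u) || (z == v) = (z == x) || (z == y)) ->
  ((u, v) == (x, y)) || ((u, v) == (y, x)).
Proof.
move=> h; have := h u; have := h v; have := h x; have := h y.
rewrite !xpair_eqE !eqxx !orbT /=; rewrite ![x == _]eq_sym ![y == _]eq_sym.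
by case: (u == x); case: (v == y); case: (u == y); case: (v == x).
Qed.

Lemma ord_seq (n : nat) (s : seq nat) : all (fun i => i < n) s ->
  exists es : seq 'I_n, map val es = s.
Proof.
elim: s => [|i s IH] /=; first by exists [::].
by case/andP=> ilt /IH[es <-]; exists (Ordinal ilt :: es).
Qed.

Lemma size_labels H : size (labels H) = size (gE H).
Proof. exact: size_map. Qed.

(** [is_cycle] works with positions in the edge list, [circuit] with labels. Since labels are
    unique, [lab] identifies the two, and both notions then amount to a cyclic walk. *)
Lemma is_cycleE E H (p : pred nat) : realises E H ->
  is_cycle H [set i | p (nth 0 (labels H) (val i))] <-> circuit E (labels H) p.
Proof.
move=> [uL ll hE hV]; set L := labels H in uL ll hV *.
have sL : size L = size (gE H) by apply: size_labels.
pose lab (i : 'I_(size (gE H))) := nth 0 L (val i).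
have labI : injective lab.
  move=> i j /eqP; rewrite nth_uniq ?sL ?ltn_ord // => /eqP; exact: val_inj.
have incL k : k < size (gE H) -> forall x,
    inc E (nth 0 L k) x = (x == (ends H k).1) || (x == (ends H k).2).
  move=> kn x; rewrite /L /labels (nth_map (0, (0, 0))) //.
  by apply: hE; apply: mem_nth.
split.
- move=> [vs [es [s2 sv /andP[uv ue] eS h]]].
  have cw : cyclic_walk E vs (map lab es).
    split; rewrite ?size_map ?map_inj_uniq // => i ilt x.
    have [i0 _] : exists i0 : 'I_(size (gE H)), i0 \in es.
      by case: (es) s2 => [|i0 ?] // _; exists i0; rewrite mem_head.
    have := h i ilt; rewrite (nth_map i0) // (nth_map i0) // /lab incL ?ltn_ord //.
    by case/orP=> /eqP -> //=; rewrite orbC.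
  apply: circuit_ext (cyclic_walk_circuit cw uL _).
    move=> l /(nthP 0)[k]; rewrite sL => kn <- /=.
    rewrite -[nth 0 L k]/(lab (Ordinal kn)).
    have := in_set (mem es) (Ordinal kn); rewrite -eS inE => ->.
    by rewrite [LHS](mem_map labI).
  by move=> l /mapP[i _ ->]; apply: mem_nth; rewrite sL ltn_ord.
move=> ci; have [vs [ls [[s2 sv uv ul h] sub ep]]] := circuit_cyclic_walk uL ll ci.
have [|es ees] := @ord_seq (size (gE H)) (map (index^~ L) ls).
  by apply/allP => k /mapP[l ll_ ->]; rewrite -sL index_mem sub.
have ses : size es = size ls by have := congr1 size ees; rewrite !size_map.
exists vs, es; split; rewrite ?ses //.
- rewrite uv -(map_inj_uniq val_inj) ees map_inj_in_uniq // => k l /sub kL /sub lL ekl.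
  by rewrite -(nth_index 0 kL) ekl nth_index.
- apply/setP=> i; rewrite !inE -(mem_map val_inj) ees ep ?mem_nth ?sL ?ltn_ord //.
  apply/idP/mapP => [il|[l ll_ ->]]; last by rewrite nth_index // sub.
  by exists (nth 0 L (val i)) => //; rewrite index_uniq ?sL ?ltn_ord.
move=> i ilt /=; rewrite ees (nth_map 0) //.
have iL : nth 0 ls i \in L by apply/sub/mem_nth.
have kn : index (nth 0 ls i) L < size (gE H) by rewrite -sL index_mem.
have := incL _ kn; rewrite nth_index //; case: (ends H _) => u v /= huv.
by apply: same_pair => z; rewrite -huv h.
Qed.

Lemma card_preim_partition (T : finType) (g : T -> nat) :
  #|preim_partition g [set: T]| = size (undup (map g (enum T))).
Proof.
pose F k := [set y | g y == k].
have FI : {in undup (map g (enum T)) &, injective F}.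
  move=> k j; rewrite !mem_undup => /mapP[x _ ->] _ /setP/(_ x).
  by rewrite !inE eqxx => /esym/eqP.
rewrite -(size_map F) -(card_uniqP _); last by rewrite map_inj_in_uniq ?undup_uniq.
apply: eq_card => S; apply/imsetP/mapP => [[x _ ->]|[k]].
  exists (g x); first by rewrite mem_undup map_f ?mem_enum.
  by apply/setP=> y; rewrite !inE eq_sym.
rewrite mem_undup => /mapP[x _ ->] ->; exists x => //.
by apply/setP=> y; rewrite !inE eq_sym.
Qed.

Lemma dec_cycle_decomposition E H n : realises E H ->
  dec E (labels H) n <->
  exists2 D, is_cycle_decomposition H D & #|D| = n.
Proof.
move=> rH; have [uL ll hE hV] := rH.
have sL := size_labels H; set L := labels H in uL ll hV sL *.
pose lab (i : 'I_(size (gE H))) := nth 0 L (val i).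
have mapL : map lab (enum 'I_(size (gE H))) = L.
  apply: (@eq_from_nth _ 0); rewrite size_map size_enum_ord ?sL // => i ilt.
  by rewrite (nth_map (Ordinal ilt)) ?size_enum_ord // /lab /= nth_enum_ord.
have labL i : lab i \in L by apply: mem_nth; rewrite sL ltn_ord.
have indlab i : index (lab i) L = i by apply: index_uniq; rewrite ?sL ?ltn_ord.
split.
- move=> [col [-> h]]; exists (preim_partition (col \o lab) [set: _]); last first.
    by rewrite card_preim_partition map_comp mapL.
  split; first exact: preim_partitionP.
  move=> S /imsetP[i _ ->].
  have -> : [set y in [set: 'I_(size (gE H))] | (col \o lab) i == (col \o lab) y] =
      [set y | [pred m | col m == col (lab i)] (nth 0 L (val y))].
    by apply/setP=> y; rewrite !inE /= eq_sym.
  by apply/(is_cycleE _ rH); apply: h.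
move=> [D [pD cD] <-].
pose g (i : 'I_(size (gE H))) : nat := enum_rank (pblock D i).
(* [insub] fails only for labels outside [L], so the default colour 0 is never seen on [L]. *)
pose col l := if insub (index l L) is Some i then g i else 0.
have collab i : col (lab i) = g i by rewrite /col indlab valK.
have /and3P[/eqP covD trD _] := pD.
have gE_ i j : (g i == g j) = (j \in pblock D i).
  rewrite /g (inj_eq val_inj) (inj_eq enum_rank_inj).
  by rewrite eq_pblock // covD inE.
exists col; split.
  rewrite -mapL -map_comp (eq_map collab) -card_preim_partition.
  congr #|pred_of_set _|; apply/setP=> S; apply/idP/imsetP => [SD|[i _ ->]].
    have [i iS] : exists i, i \in S.
      by apply/set0Pn; apply: contraTneq SD => ->; case/and3P: pD.
    exists i => //; apply/setP=> j; rewrite !inE gE_.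
    by rewrite (def_pblock trD SD iS).
  have -> : [set y in [set: 'I_(size (gE H))] | g i == g y] = pblock D i.
    by apply/setP=> j; rewrite !inE gE_.
  by rewrite pblock_mem // covD inE.
move=> l lL; apply/(is_cycleE _ rH).
have ln : index l L < size (gE H) by rewrite -sL index_mem.
have el : l = lab (Ordinal ln) by rewrite /lab /= nth_index.
have -> : [set i : 'I_(size (gE H)) | col (nth 0 (labels H) (val i)) == col l] =
          pblock D (Ordinal ln).
  apply/setP=> j; rewrite inE [X in _ == col X]el -/(lab j) !collab eq_sym.
  exact: gE_.
by apply: cD; rewrite pblock_mem // covD inE.
Qed.

(** * Extremal numbers of cycles *)

Lemma bigmin_leq (I : finType) (P : pred I) (F : I -> nat) (m : nat) i :
  P i -> \big[minn/m]_(i | P i) F i <= F i.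
Proof.
move=> Pi; have : i \in index_enum I by apply: mem_index_enum.
elim: (index_enum I) => [//|j r IH]; rewrite big_cons in_cons.
case/predU1P => [<-|/IH le]; first by rewrite Pi geq_minl.
by case: (P j) => //; apply: leq_trans le; apply: geq_minr.
Qed.

(** The bound on [F] keeps the default [m] from undercutting every actual value, so the minimum is
    attained. *)
Lemma bigmin_mem (I : finType) (P : pred I) (F : I -> nat) (m : nat) i0 :
  P i0 -> (forall i, P i -> F i <= m) ->
  exists2 i, P i & \big[minn/m]_(i | P i) F i = F i.
Proof.
move=> Pi0 Fm; case: (arg_minnP F Pi0) => i Pi hi; exists i => //.
apply/eqP; rewrite eqn_leq; apply/andP; split.
  exact: bigmin_leq.
by elim/big_ind: _ => [|x y hx hy|j /hi//]; [apply: Fm | rewrite leq_min hx].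
Qed.

Lemma cmin_dec E H : realises E H -> (exists n, dec E (labels H) n) ->
  dec E (labels H) (cmin H) /\ forall n, dec E (labels H) n -> cmin H <= n.
Proof.
move=> rH [n /(dec_cycle_decomposition _ rH) [D0 hD0 _]].
(* Blocks are non-empty, so there are at most as many cycles as edges, and the default of [cmin] is
   never below an actual count. *)
have hm (D : {set {set 'I_(size (gE H))}}) :
    `[< is_cycle_decomposition H D >] -> #|D| <= size (gE H).
  move=> /asboolP[pD _]; have /and3P[_ _ nD] := pD.
  apply: leq_trans (_ : \sum_(S in D) #|S| <= _); last first.
    by rewrite -(card_partition pD) cardsT card_ord.
  rewrite -sum1_card; apply: leq_sum => S SD; rewrite card_gt0.
  by apply: contraTneq SD => ->.
split.
  have [D /asboolP hD eD] := bigmin_mem (asboolT hD0) hm.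
  by apply/(dec_cycle_decomposition _ rH); exists D; rewrite // /cmin eD.
move=> k /(dec_cycle_decomposition _ rH) [D hD <-].
by apply: bigmin_leq; apply/asboolP.
Qed.

Lemma numax_dec E H : realises E H -> (exists n, dec E (labels H) n) ->
  dec E (labels H) (numax H) /\ forall n, dec E (labels H) n -> n <= numax H.
Proof.
move=> rH [n /(dec_cycle_decomposition _ rH) [D0 hD0 _]].
split.
  have : 0 < #|[pred D | `[< is_cycle_decomposition H D >]]|.
    by apply/card_gt0P; exists D0; apply/asboolP.
  case/(eq_bigmax_cond (fun D : {set {set 'I_(size (gE H))}} => #|D|)) => D /asboolP hD eD.
  by apply/(dec_cycle_decomposition _ rH); exists D; rewrite // /numax eD.
move=> k /(dec_cycle_decomposition _ rH) [D hD <-].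
by apply: (leq_bigmax_cond (F := fun D : {set {set 'I_(size (gE H))}} => #|D|)); apply/asboolP.
Qed.

Lemma wf_realises H : wf H -> exists E, realises E H.
Proof.
move=> [_ uL hV nl].
pose E l := (nth (0, (0, 0)) (gE H) (index l (labels H))).2.
have hE e : e \in gE H -> E e.1 = e.2.
  move=> eH; have iH : index e (gE H) < size (gE H) by rewrite index_mem.
  rewrite /E (_ : index e.1 (labels H) = index e (gE H)) ?nth_index //.
  have -> : e.1 = nth 0 (labels H) (index e (gE H)).
    by rewrite (nth_map (0, (0, 0))) // nth_index.
  by rewrite index_uniq // size_labels.
exists E; split=> // [l /mapP[e eH ->]|e eH x|l x /mapP[e eH ->]].
- by rewrite hE // nl.
- by rewrite /inc hE.
- by rewrite /inc hE // => /orP[] /eqP ->; case/andP: (hV _ eH).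
Qed.

Lemma eulerian_dec E H : realises E H -> eulerian H -> exists n, dec E (labels H) n.
Proof.
move=> [uL ll hE hV] eu; apply: even_dec => // x.
case xV: (x \in gV H); last first.
  by apply: par_noinc => l lL _; apply: contraFF xV => /hV; apply.
have <- : odd (degree H x) = false by apply/negbTE/eu.
rewrite /degree /par /labels big_map -sum1_count.
rewrite (big_morph odd oddD (erefl : odd 0 = false)) [RHS]big_mkcond.
apply: eq_big_seq => e eH /=; rewrite hE // ![x == _]eq_sym.
by case: ifP.
Qed.

(** * Tree structure of the pieces *)

(** Decidable equality on pieces, so that membership and [perm_eq] apply to lists of them. *)
Definition mgraph_pair (H : mgraph) := (gV H, gE H).
Definition pair_mgraph (u : seq nat * seq (nat * (nat * nat))) := MGraph u.1 u.2.
Lemma mgraph_pairK : cancel mgraph_pair pair_mgraph. Proof. by case. Qed.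
HB.instance Definition _ := Equality.copy mgraph (can_type mgraph_pairK).

Definition verts (s : seq mgraph) : seq nat := flatten (map gV s).

Definition meet (E : nat -> nat * nat) (f : nat) (P Q : mgraph) : Prop :=
  [/\ f \in labels P, f \in labels Q,
      forall g, g \in labels P -> g \in labels Q -> g = f &
      forall x, x \in gV P -> x \in gV Q -> inc E f x].

(** Only the unions of the labels and of the vertices of [s] matter, so [s] may be permuted or
    regrouped. *)
Definition attach (E : nat -> nat * nat) (Q : mgraph) (s : seq mgraph) : Prop :=
  exists f, [/\ f \in labels Q, f \in all_labels s,
      forall g, g \in labels Q -> g \in all_labels s -> g = f &
      forall x, x \in gV Q -> x \in verts s -> inc E f x].

(* Newest piece first: the root of the tree is the last element of [s]. *)
Fixpoint tree_order (E : nat -> nat * nat) (s : seq mgraph) : Prop :=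
  if s is Q :: s' then tree_order E s' /\ (s' = [::] \/ attach E Q s') else True.

Definition treelike (E : nat -> nat * nat) (s : seq mgraph) : Prop :=
  exists2 o, perm_eq o s & tree_order E o.

(** A virtual edge has its two copies and no more, so a label shared by two pieces occurs in no
    third one. *)
Definition few_labels (s : seq mgraph) : Prop :=
  forall g, count_mem g (all_labels s) <= 2.

Definition ends_inside (E : nat -> nat * nat) (s : seq mgraph) : Prop :=
  forall P, P \in s -> forall l x, l \in labels P -> inc E l x -> x \in gV P.

Lemma all_labelsP s g :
  reflect (exists2 P, P \in s & g \in labels P) (g \in all_labels s).
Proof. exact: (iffP flatten_mapP). Qed.

Lemma all_labels_cat s t : all_labels (s ++ t) = all_labels s ++ all_labels t.
Proof. by rewrite /all_labels map_cat flatten_cat. Qed.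

Lemma verts_cat s t : verts (s ++ t) = verts s ++ verts t.
Proof. by rewrite /verts map_cat flatten_cat. Qed.

Lemma all_labels1 P : all_labels [:: P] = labels P.
Proof. exact: cats0. Qed.

Lemma verts1 P : verts [:: P] = gV P.
Proof. exact: cats0. Qed.

Lemma perm_all_labels s t : perm_eq s t -> perm_eq (all_labels s) (all_labels t).
Proof. by move=> st; apply/perm_flatten/perm_map. Qed.

Lemma perm_verts s t : perm_eq s t -> perm_eq (verts s) (verts t).
Proof. by move=> st; apply/perm_flatten/perm_map. Qed.

Lemma meet_sym E f P Q : meet E f P Q -> meet E f Q P.
Proof.
by case=> fP fQ h1 h2; split=> // [g gQ gP|x xQ xP]; [apply: h1 | apply: h2].
Qed.

Lemma attach1 E P Q : attach E P [:: Q] <-> exists f, meet E f P Q.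
Proof.
rewrite /attach all_labels1 verts1; split=> -[f] [fP fQ h1 h2]; exists f;
by split.
Qed.

Lemma attach_sub E Q s t :
  (forall g, g \in labels Q -> (g \in all_labels s) = (g \in all_labels t)) ->
  (forall x, x \in gV Q -> x \in verts t -> x \in verts s) ->
  attach E Q s -> attach E Q t.
Proof.
move=> hl hv [f [fQ fs h1 h2]]; exists f; split=> //.
- by rewrite -hl.
- by move=> g gQ; rewrite -hl //; apply: h1.
- by move=> x xQ xt; apply: h2; rewrite ?hv.
Qed.

Lemma attach_perm E Q s t : perm_eq s t -> attach E Q s -> attach E Q t.
Proof.
move=> st; apply: attach_sub => [g _|x _].
  exact: perm_mem (perm_all_labels st) _.
by rewrite (perm_mem (perm_verts st)).
Qed.

Lemma few_labels_perm s t : perm_eq s t -> few_labels s -> few_labels t.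
Proof. by move=> st fs g; rewrite -(permP (perm_all_labels st)). Qed.

Lemma few_labels_cons Q s : few_labels (Q :: s) -> few_labels s.
Proof. by move=> h g; have := h g; rewrite /= /all_labels /= count_cat; lia. Qed.

Lemma few_labels_notin P Q s g : few_labels (P :: Q :: s) ->
  g \in labels P -> g \in labels Q -> g \notin all_labels s.
Proof.
move=> /(_ g); rewrite -(cat1s P) -(cat1s Q) !all_labels_cat !all_labels1.
rewrite !count_cat => h gP gQ.
have : 0 < count_mem g (labels P) by rewrite -has_count has_pred1.
have : 0 < count_mem g (labels Q) by rewrite -has_count has_pred1.
by move=> *; apply/count_memPn; lia.
Qed.

Lemma ends_inside_perm E s t : perm_eq s t -> ends_inside E s -> ends_inside E t.
Proof. by move=> st h P Pt; apply: h; rewrite (perm_mem st). Qed.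

Lemma tree_order_cat E s r : tree_order E (s ++ r) -> tree_order E r.
Proof. by elim: s => [//|Q s IH] /= [/IH]. Qed.

(** The pieces of [s] see what lies below them only through its union. So the bottom [r] may be
    exchanged for any [r'] that shows them the same labels and no further vertices. *)
Lemma tree_order_graft E s r r' : r != [::] -> r' != [::] ->
  tree_order E (s ++ r) -> tree_order E r' ->
  (forall g, g \in all_labels s -> (g \in all_labels r) = (g \in all_labels r')) ->
  (forall x, x \in verts s -> x \in verts r' -> x \in verts r) ->
  tree_order E (s ++ r').
Proof.
move=> r0 r'0; elim: s => [//|Q s IH] /= [ts hQ] tr' hl hv.
split.
  apply: IH => // [g gs|x xs]; [apply: hl | apply: hv].
    by rewrite -cat1s all_labels_cat mem_cat gs orbT.
  by rewrite -cat1s verts_cat mem_cat xs orbT.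
case: hQ => [|att]; first by case: s {IH ts hl hv} => //; case: r r0.
right; apply: attach_sub att => [g gQ|x xQ].
  rewrite !all_labels_cat !mem_cat hl // -cat1s all_labels_cat mem_cat all_labels1.
  by rewrite gQ.
rewrite !verts_cat !mem_cat; case: (x \in verts s) => //=; apply: hv.
by rewrite -cat1s verts_cat mem_cat verts1 xQ.
Qed.

(** Attachment of two single pieces is symmetric, so [Q] can go below the old root [R]. The pieces
    of [o] notice nothing: they do not carry [f], and the vertices they share with [Q] are ends of
    [f], hence already in [R]. *)
Lemma tree_order_new_root E o R Q f : tree_order E (o ++ [:: R]) ->
  ends_inside E [:: R] -> f \in labels Q -> f \in labels R ->
  f \notin all_labels o ->
  (forall g, g \in labels Q -> g \in all_labels (o ++ [:: R]) -> g = f) ->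
  (forall x, x \in gV Q -> x \in verts (o ++ [:: R]) -> inc E f x) ->
  tree_order E (o ++ [:: R; Q]).
Proof.
move=> to eR fQ fR fo hl hv; apply: tree_order_graft (to) _ _ _ => //.
- split; first by split=> //; left.
  right; apply/attach1; exists f; split=> //.
    by move=> g gR gQ; apply: hl; rewrite // all_labels_cat mem_cat all_labels1 gR orbT.
  by move=> x xR xQ; apply: hv; rewrite // verts_cat mem_cat verts1 xR orbT.
- move=> g go; rewrite -(cat1s R [:: Q]) (all_labels_cat [:: R]) !all_labels1 mem_cat.
  case gQ: (g \in labels Q); last by rewrite orbF.
  have egf : g = f by apply: hl; rewrite // all_labels_cat mem_cat go.
  by case/negP: fo; rewrite -egf.
- move=> x xo; rewrite -(cat1s R [:: Q]) (verts_cat [:: R]) !verts1 mem_cat.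
  case/orP=> // xQ; apply: (eR R (mem_head _ _) f) => //.
  by apply: hv; rewrite // verts_cat mem_cat xo.
Qed.

(** If the newest piece is to become the root, the older ones are first rerooted at the piece [R]
    carrying its attaching label; the newest piece then goes below [R]. *)
Lemma tree_order_reroot E o P : few_labels o -> ends_inside E o ->
  tree_order E o -> P \in o ->
  exists2 o', perm_eq (o' ++ [:: P]) o & tree_order E (o' ++ [:: P]).
Proof.
elim: o P => [//|Q s IH] P fl ei /= [ts hQ].
have fls := few_labels_cons fl.
have eis : ends_inside E s by move=> R Rs; apply: ei; rewrite in_cons Rs orbT.
rewrite in_cons => /predU1P[->|Ps]; last first.
  have [o' po to] := IH P fls eis ts Ps.
  exists (Q :: o') => /=; first by rewrite perm_cons.
  split=> //; right; case: hQ => [s0|]; first by rewrite s0 in Ps.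
  by apply: attach_perm; rewrite perm_sym.
case: hQ => [->|[f [fQ fs hl hv]]]; first by exists [::]; rewrite ?perm_refl //; split=> //; left.
have /all_labelsP[R Rs fR] := fs.
have [o' po to] := IH R fls eis ts Rs.
exists (o' ++ [:: R]); first by rewrite perm_catC /= perm_cons.
rewrite -catA; apply: (tree_order_new_root to _ fQ fR).
- by move=> R'; rewrite inE => /eqP ->; apply: eis.
- apply: (few_labels_notin _ fQ fR); apply: few_labels_perm fl.
  by rewrite perm_cons perm_sym; apply: perm_trans po; rewrite perm_sym perm_catC.
- by move=> g gQ; rewrite (perm_mem (perm_all_labels po)); apply: hl.
- by move=> x xQ; rewrite (perm_mem (perm_verts po)); apply: hv.
Qed.

(** Pieces newer than [Q] keep their places. [Q] itself is attached through a single label, which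
    must be [f] because the root [P] carries it; so [Q] can go below [P]. *)
Lemma tree_order_pull E o P Q rest f : tree_order E (o ++ [:: P]) ->
  ends_inside E [:: P] -> few_labels (P :: Q :: rest) ->
  perm_eq o (Q :: rest) -> f \in labels P -> f \in labels Q ->
  exists2 o', perm_eq o' rest &
    tree_order E (o' ++ [:: P; Q]) \/ tree_order E (o' ++ [:: Q; P]).
Proof.
move=> to ei fl po fP fQ.
elim: o rest to fl po => [|X o IH] rest to fl po.
  by have := perm_size po.
case: to => to hX.
case: (eqVneq X Q) po hX => [-> po hX|XQ po hX].
  rewrite perm_cons in po; exists o => //; left.
  case: hX => [|[g [gQ gP hl hv]]]; first by case: (o).
  have fg : f = g by apply: hl; rewrite // all_labels_cat mem_cat all_labels1 fP orbT.
  rewrite -fg in gQ gP hl hv.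
  apply: (tree_order_new_root to _ fQ fP _ hl hv) => //.
  rewrite (perm_mem (perm_all_labels po)); exact: few_labels_notin fl fP fQ.
have Xr : X \in rest.
  by have := perm_mem po X; rewrite !in_cons eqxx (negbTE XQ) /= => <-.
have pr := perm_to_rem Xr.
have po' : perm_eq o (Q :: rem X rest).
  rewrite -(perm_cons X); apply: perm_trans po _.
  by rewrite perm_sym (perm_catCA [:: X] [:: Q]) perm_cons perm_sym.
have [|o' pp tt] := IH (rem X rest) to _ po'.
  apply: (@few_labels_cons X); apply: few_labels_perm fl.
  rewrite perm_sym (perm_catCA [:: X] [:: P; Q]) /= !perm_cons perm_sym //.
exists (X :: o'); first by rewrite perm_sym (perm_trans pr) // perm_cons perm_sym.
have q1 : perm_eq (o ++ [:: P]) (o' ++ [:: P; Q]).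
  rewrite perm_catC perm_sym perm_catC /= perm_cons perm_sym.
  by apply: perm_trans po' _; rewrite perm_cons perm_sym.
have q2 : perm_eq (o ++ [:: P]) (o' ++ [:: Q; P]).
  by apply: perm_trans q1 _; rewrite perm_cat2l (perm_catC [:: P] [:: Q]).
have aX r : perm_eq (o ++ [:: P]) r -> attach E X r.
  move=> pr'; case: hX => [|]; first by case: (o).
  exact: attach_perm.
by case: tt => tt; [left | right]; split=> //; right; apply: aX.
Qed.

Lemma tree_order_pair E P Q f : tree_order E [:: P; Q] ->
  f \in labels P -> f \in labels Q -> meet E f P Q.
Proof.
case=> _ [//|/attach1[g [gP gQ h1 h2]]] fP fQ.
by have -> : f = g by apply: h1.
Qed.

(** With [P] as root and [Q] pulled next to it, the two form the bottom of the order and are grafted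
    away for [R]. The label [f] that disappears is carried by no other piece. *)
Lemma treelike_merge E P Q rest s R f :
  few_labels s -> ends_inside E s -> treelike E s ->
  perm_eq s (P :: Q :: rest) -> f \in labels P -> f \in labels Q ->
  (forall g, (g \in labels R) = (g != f) && ((g \in labels P) || (g \in labels Q))) ->
  (forall x, (x \in gV R) = (x \in gV P) || (x \in gV Q)) ->
  meet E f P Q /\ treelike E (R :: rest).
Proof.
move=> fl ei [o po to] ps fP fQ hl hv.
have pos : perm_eq o (P :: Q :: rest) by apply: perm_trans po ps.
have fl' := few_labels_perm ps fl.
have pso : perm_eq s o by rewrite perm_sym.
have Po : P \in o by rewrite (perm_mem pos) mem_head.
have [o1 p1 t1] := tree_order_reroot (few_labels_perm pso fl) (ends_inside_perm pso ei) to Po.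
have p2 : perm_eq o1 (Q :: rest).
  rewrite -(perm_cons P); apply: perm_trans pos; apply: perm_trans p1.
  by rewrite perm_sym perm_catC.
have eP : ends_inside E [:: P].
  by move=> P'; rewrite inE => /eqP ->; apply: (ei P); rewrite (perm_mem ps) mem_head.
have [o' p' t'] := tree_order_pull t1 eP fl' p2 fP fQ.
have mE : meet E f P Q.
  case: t' => /tree_order_cat t; first exact: tree_order_pair t fP fQ.
  by apply: meet_sym; apply: tree_order_pair t fQ fP.
split=> //; exists (o' ++ [:: R]); first by rewrite perm_catC /= perm_cons.
have fo' : f \notin all_labels o'.
  by rewrite (perm_mem (perm_all_labels p')); apply: few_labels_notin fl' fP fQ.
have gP g : g \in all_labels o' -> g != f by apply: contraTneq => ->.
case: t' => t; apply: tree_order_graft (t) _ _ _ => //; try by split=> //; left.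
- move=> g go; rewrite -(cat1s P [:: Q]) (all_labels_cat [:: P]) !all_labels1 mem_cat.
  by rewrite hl gP.
- by move=> x _; rewrite -(cat1s P [:: Q]) (verts_cat [:: P]) !verts1 mem_cat hv.
- move=> g go; rewrite -(cat1s Q [:: P]) (all_labels_cat [:: Q]) !all_labels1 mem_cat.
  by rewrite hl gP //= orbC.
- by move=> x _; rewrite -(cat1s Q [:: P]) (verts_cat [:: Q]) !verts1 mem_cat hv orbC.
Qed.

(** With [H] as root, the graft replaces it by the two new pieces; the fresh label [f] is invisible
    to all others. *)
Lemma treelike_split E P Q H rest s f :
  few_labels s -> ends_inside E s -> treelike E s ->
  perm_eq s (H :: rest) -> f \notin all_labels s -> meet E f P Q ->
  (forall g, (g \in labels P) || (g \in labels Q) = (g == f) || (g \in labels H)) ->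
  (forall x, (x \in gV P) || (x \in gV Q) = (x \in gV H)) ->
  treelike E (P :: Q :: rest).
Proof.
move=> fl ei [o po to] ps fs mE hl hv.
have pos : perm_eq o (H :: rest) by apply: perm_trans po ps.
have pso : perm_eq s o by rewrite perm_sym.
have Ho : H \in o by rewrite (perm_mem pos) mem_head.
have [o1 p1 t1] := tree_order_reroot (few_labels_perm pso fl) (ends_inside_perm pso ei) to Ho.
have p2 : perm_eq o1 rest.
  rewrite -(perm_cons H); apply: perm_trans pos; apply: perm_trans p1.
  by rewrite perm_sym perm_catC.
exists (o1 ++ [:: P; Q]); first by rewrite perm_catC /= !perm_cons.
apply: tree_order_graft (t1) _ _ _ => //.
- by split; [split=> //; left | right; apply/attach1; exists f].
- move=> g go; rewrite -(cat1s P [:: Q]) (all_labels_cat [:: P]) !all_labels1 mem_cat.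
  rewrite hl; case: eqP go => [->|//] fo; case/negP: fs.
  rewrite (perm_mem (perm_all_labels ps)) -cat1s all_labels_cat mem_cat.
  by rewrite -(perm_mem (perm_all_labels p2)) fo orbT.
- by move=> x _; rewrite -(cat1s P [:: Q]) (verts_cat [:: P]) !verts1 mem_cat hv.
Qed.

Lemma treelike_eq E E' s : {in all_labels s, E =1 E'} -> treelike E s -> treelike E' s.
Proof.
move=> hE [o po to]; exists o => //.
have {}hE : {in all_labels o, E =1 E'}.
  by move=> g; rewrite (perm_mem (perm_all_labels po)); apply: hE.
elim: o {po} to hE => [//|Q s' IH] /= [ts hQ] hE.
have sub : {subset all_labels s' <= all_labels (Q :: s')}.
  by move=> g gs; rewrite -cat1s all_labels_cat mem_cat gs orbT.
split; first by apply: IH => // g /sub; apply: hE.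
case: hQ => [|[f [fQ fs hl hv]]]; [by left | right].
exists f; split=> // x xQ xs; rewrite /inc -hE ?sub //.
exact: hv.
Qed.

(** * Splits and merges *)

(** The roles are asymmetric: [a] has degree two in [Q], where it meets just [f] and [e]. *)
Definition is_twosum (E : nat -> nat * nat) (f : nat) (H P Q : mgraph) : Prop :=
  exists A B a c e,
    [/\ [/\ perm_eq (labels P) (f :: A), perm_eq (labels Q) (f :: B)
          & perm_eq (labels H) (A ++ B)],
        meet E f P Q,
        a != c /\ (forall x, inc E f x = (x == a) || (x == c)) &
        e \in B /\ {in B, forall l, inc E l a = (l == e)}].

Lemma twosum_dec E f H P Q :
  realises E H -> realises E P -> realises E Q -> is_twosum E f H P Q ->
  (forall n, dec E (labels H) n -> exists n1 n2,
     [/\ dec E (labels P) n1, dec E (labels Q) n2 & n + 1 = n1 + n2]) /\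
  (forall n1 n2, dec E (labels P) n1 -> dec E (labels Q) n2 ->
     exists2 n, dec E (labels H) n & n + 1 = n1 + n2).
Proof.
move=> [uH lH hH vH] [uP lP hP vP] [uQ lQ hQ vQ].
move=> [A [B [a [c [e [[pP pQ pH] [fP fQ hl hv] [nac incf] [eB deg2]]]]]]].
have uAB : uniq (f :: A ++ B).
  rewrite /= -(perm_uniq pH) uH andbT mem_cat; apply/negP => /orP[] fA.
    by move: uP; rewrite (perm_uniq pP) /= fA.
  by move: uQ; rewrite (perm_uniq pQ) /= fA.
have llAB : loopless E (A ++ B) by move=> l; rewrite -(perm_mem pH); apply: lH.
(* A vertex common to both summands would be an end of [f]. *)
have sep x : x != a -> x != c ->
  {in A, forall l, inc E l x = false} \/ {in B, forall l, inc E l x = false}.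
  move=> xa xc; case xP: (x \in gV P); [right|left] => l lAB.
    apply: contraFF (negbTE xa) => lx.
    have : inc E f x.
      apply: hv => //; apply: (vQ l) => //; by rewrite (perm_mem pQ) in_cons lAB orbT.
    by rewrite incf (negbTE xc) orbF.
  by apply: contraFF xP; apply: vP; rewrite (perm_mem pP) in_cons lAB orbT.
split=> [n dn|n1 n2 d1 d2].
  have [n1 [n2 [d1 d2 e12]]] := dec_twosum_split uAB llAB nac incf sep eB deg2 (dec_perm pH dn).
  exists n1, n2; split=> //; first by apply: dec_perm d1; rewrite perm_sym.
  by apply: dec_perm d2; rewrite perm_sym.
have [n dn e12] := dec_twosum_join uAB llAB nac incf sep eB deg2 (dec_perm pP d1) (dec_perm pQ d2).
by exists n => //; apply: dec_perm dn; rewrite perm_sym.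
Qed.

(** Splitting an optimal decomposition of [H] gives one inequality, joining optimal ones of [P] and
    [Q] the other. *)
Lemma twosum_cmin_numax E f H P Q :
  realises E H -> realises E P -> realises E Q -> is_twosum E f H P Q ->
  (exists n, dec E (labels H) n) ->
  cmin H + 1 = cmin P + cmin Q /\ numax H + 1 = numax P + numax Q.
Proof.
move=> rH rP rQ ts xH; have [spl jn] := twosum_dec rH rP rQ ts.
have [xP xQ] : (exists n, dec E (labels P) n) /\ (exists n, dec E (labels Q) n).
  by case: xH => n /spl [n1 [n2 [d1 d2 _]]]; split; [exists n1 | exists n2].
have [cH mH] := cmin_dec rH xH; have [cP mP] := cmin_dec rP xP.
have [cQ mQ] := cmin_dec rQ xQ.
have [dH uH] := numax_dec rH xH; have [dP uP] := numax_dec rP xP.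
have [dQ uQ] := numax_dec rQ xQ.
split.
  have [n1 [n2 [/mP d1 /mQ d2 e12]]] := spl _ cH.
  have [n /mH dn en] := jn _ _ cP cQ; lia.
have [n1 [n2 [/uP d1 /uQ d2 e12]]] := spl _ dH.
have [n /uH dn en] := jn _ _ dP dQ; lia.
Qed.

Definition good (E : nat -> nat * nat) (s : seq mgraph) : Prop :=
  [/\ forall H, H \in s -> realises E H /\ exists n, dec E (labels H) n,
      few_labels s & treelike E s].

Lemma good_perm E s t : perm_eq s t -> good E s -> good E t.
Proof.
move=> st [h1 h2 [o po to]]; split.
- by move=> H; rewrite -(perm_mem st); apply: h1.
- exact: few_labels_perm h2.
- by exists o => //; apply: perm_trans st.
Qed.

Lemma good_ends_inside E s : good E s -> ends_inside E s.
Proof. by move=> [h _ _] P /h [[]]. Qed.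

Lemma realises_eq E E' H : {in labels H, E =1 E'} -> realises E H -> realises E' H.
Proof.
move=> hE [uH lH hH vH]; split=> //.
- by move=> l lL; rewrite -hE // lH.
- move=> e eH x; rewrite -hH // /inc hE //; exact: map_f.
- by move=> l x lL; rewrite /inc -hE //; apply: vH.
Qed.

Lemma dec_eq E E' L n : {in L, E =1 E'} -> dec E L n -> dec E' L n.
Proof.
move=> hE; have hp p x : par E L p x = par E' L p x.
  by apply: eq_big_seq => l lL; rewrite /inc hE.
move=> [col [-> h]]; exists col; split=> // l lL.
have [ev hp_ mi] := h l lL; split=> //; first by move=> x; rewrite -hp.
by move=> q evq; apply: mi => x; rewrite hp.
Qed.

Lemma good_eq E E' s : {in all_labels s, E =1 E'} -> good E s -> good E' s.
Proof.
move=> hE [h1 h2 h3]; split=> //; last exact: treelike_eq h3.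
move=> H Hs; have [rH [n dn]] := h1 _ Hs.
have hE' : {in labels H, E =1 E'}.
  by move=> l lH; apply: hE; apply/all_labelsP; exists H.
by split; [apply: realises_eq rH | exists n; apply: dec_eq dn].
Qed.

(* [sum F - size] agrees on [s] and [t], written without subtraction. *)
Definition excess (F : mgraph -> nat) (s t : seq mgraph) : Prop :=
  \sum_(H <- t) F H + size s = \sum_(H <- s) F H + size t.

Lemma excess_perm F s t s' t' : perm_eq s s' -> perm_eq t t' ->
  excess F s t -> excess F s' t'.
Proof.
by move=> ps pt; rewrite /excess (perm_big _ ps) (perm_big _ pt) (perm_size ps) (perm_size pt).
Qed.

Lemma good_split E f H P Q rest : good E (H :: rest) ->
  realises E P -> realises E Q -> is_twosum E f H P Q ->
  f \notin all_labels (H :: rest) ->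
  (forall x, (x \in gV P) || (x \in gV Q) = (x \in gV H)) ->
  [/\ good E (P :: Q :: rest),
      excess cmin (H :: rest) (P :: Q :: rest) &
      excess numax (H :: rest) (P :: Q :: rest)].
Proof.
move=> gs rP rQ ts fs hv; have [h1 h2 h3] := gs.
have [rH xH] := h1 H (mem_head _ _).
have [e1 e2] := twosum_cmin_numax rH rP rQ ts xH.
split; last 2 first.
- by rewrite /excess !big_cons /=; lia.
- by rewrite /excess !big_cons /=; lia.
have [spl _] := twosum_dec rH rP rQ ts.
have [n /spl [n1 [n2 [d1 d2 _]]]] := xH.
have [A [B [a [c [e [[pP pQ pH] mE _ _]]]]]] := ts.
split.
- move=> K; rewrite !in_cons => /or3P[/eqP->|/eqP->|Ks]; first by split=> //; exists n1.
    by split=> //; exists n2.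
  by apply: h1; rewrite in_cons Ks orbT.
(* The fresh [f] now occurs exactly twice; every other label keeps its number of occurrences. *)
- move=> g; have := h2 g; move: (fs).
  rewrite -(cat1s P) -(cat1s Q) -(cat1s H) !all_labels_cat !all_labels1.
  rewrite !count_cat (permP pP) (permP pQ) (permP pH) count_cat /=.
  rewrite mem_cat (perm_mem pH) mem_cat !negb_or.
  case/andP=> /andP[/count_memPn fA /count_memPn fB] /count_memPn fr.
  case: (eqVneq f g) fA fB fr => [->|_] fA fB fr; first by rewrite fA fB fr.
  by rewrite !add0n addnA.
- have hg g : (g \in labels P) || (g \in labels Q) = (g == f) || (g \in labels H); last first.
    exact: treelike_split h2 (good_ends_inside gs) h3 (perm_refl _) fs mE hg hv.
  rewrite (perm_mem pP) (perm_mem pQ) (perm_mem pH) mem_cat !in_cons.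
  by case: (g == f).
Qed.

Lemma realises_edge E H e : realises E H -> e \in gE H ->
  [/\ e.2.1 \in gV H, e.2.2 \in gV H & e.2.1 != e.2.2].
Proof.
move=> [uH lH hH vH] eH.
have eL : e.1 \in labels H by apply: map_f.
split.
- by apply: (vH e.1) => //; rewrite hH // eqxx.
- by apply: (vH e.1) => //; rewrite hH // eqxx orbT.
apply/negP => /eqP ee; have h := hH _ eH; have := lH _ eL.
have := h (E e.1).1; have := h (E e.1).2; rewrite /inc !eqxx orbT /= -ee orbb.
by rewrite ee orbb => /esym/eqP -> /esym/eqP ->; rewrite eqxx.
Qed.

(** * Reachability as an equivalence relation *)

Section Reach.

Variables (H : mgraph) (X L : seq nat).

Lemma adj_sym : symmetric (adj H X L).
Proof.
move=> x y; rewrite /adj.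
rewrite (eq_has (a2 := fun e : nat * (nat * nat) =>
  (e.1 \notin L) && ((e.2 == (y, x)) || (e.2 == (x, y))))); last first.
  by move=> e; rewrite orbC.
by case: (x \in gV H); case: (y \in gV H); case: (x \notin X); case: (y \notin X).
Qed.

Lemma reach_refl x : x \in gV H -> x \notin X -> reach H X L x x.
Proof. by move=> xH xX; split=> //; exists [::]. Qed.

Lemma reach_trans x y z : reach H X L x y -> reach H X L y z -> reach H X L x z.
Proof.
move=> [xH xX [p [pp lp]]] [yH yX [q [pq lq]]]; split=> //.
by exists (p ++ q); rewrite cat_path last_cat lp pp pq.
Qed.

Lemma reach_adj x y : adj H X L x y -> reach H X L x y.
Proof.
by move=> a; case/and5P: (a) => xH _ xX _ _; split=> //; exists [:: y]; rewrite /= a.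
Qed.

Lemma reach_in x y : reach H X L x y -> y \in gV H /\ y \notin X.
Proof.
move=> [xH xX [p [pp <-]]]; elim: p x xH xX pp => [//|z p IH] x xH xX /= /andP[a].
by case/and5P: a => _ zH _ zX _; apply: IH.
Qed.

Lemma reach_sym x y : reach H X L x y -> reach H X L y x.
Proof.
move=> [xH xX [p [pp <-]]]; elim: p x xH xX pp => [|z p IH] x xH xX /=.
  by move=> _; apply: reach_refl.
case/andP=> a pp; case/and5P: (a) => _ zH _ zX _.
by apply: reach_trans (IH z zH zX pp) _; apply: reach_adj; rewrite adj_sym.
Qed.

End Reach.

Lemma label_inj H : uniq (labels H) -> {in gE H &, injective elabel}.
Proof.
rewrite /labels; elim: (gE H) => [//|h s IH] /= /andP[hs us] x y.
rewrite !in_cons => /predU1P[->|xs] /predU1P[->|ys] //; last exact: IH.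
  by move=> ehy; rewrite ehy map_f in hs.
by move=> exh; rewrite -exh map_f in hs.
Qed.

(** * A 2.5-split as a 2-sum *)

Section Split.

Variables (E : nat -> nat * nat) (H : mgraph) (c : nat) (e : nat * (nat * nat)).
Variables (a b : nat) (Ca Cb : seq nat) (f : nat).
Hypothesis rH : realises E H.
Hypothesis ok : split_ok H c e a b Ca Cb.
Hypothesis fH : f \notin labels H.
Hypothesis Ef : E f = (a, c).

Let P := add_edge (induced H (c :: Ca)) (f, (a, c)).
Let Q := add_edge (add_edge (add_vertex (induced H (c :: Cb)) a) (e.1, (b, a)))
                  (f, (a, c)).

Lemma split_edge : e \in gE H.
Proof. by case: ok => -[]. Qed.

Lemma split_ca : c != a. Proof. by case: ok => _ _ /andP[]. Qed.
Lemma split_cb : c != b. Proof. by case: ok => _ _ /andP[]. Qed.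

Lemma split_ends : [/\ a \in gV H, b \in gV H & a != b].
Proof.
have [e1 e2 ne] := realises_edge rH split_edge.
by case: ok => _ /orP[] /andP[/eqP -> /eqP ->] _ _ _; split; rewrite // eq_sym.
Qed.

Lemma split_ends_or (g : nat * (nat * nat)) x y : g \in gE H -> g.1 = e.1 ->
  (g.2 == (x, y)) || (g.2 == (y, x)) -> (x == a) && (y == b) || (x == b) && (y == a).
Proof.
move=> gH ge.
have [uH _ hH _] := rH.
have geq : g = e by apply: (label_inj uH) => //; apply: split_edge.
rewrite geq; case: ok => _ + _ _ _; case: (e.2) => u v /=.
by case/orP=> /andP[/eqP -> /eqP ->]; rewrite !xpair_eqE ![_ == x]eq_sym ![_ == y]eq_sym;
   case: (x == u); case: (y == v); case: (x == v); case: (y == u).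
Qed.

Lemma split_a_Ca : a \in Ca.
Proof.
have [aH _ _] := split_ends; case: ok => _ _ _ h _; apply/(proj1 (h a)).
by apply: reach_refl; rewrite // inE eq_sym split_ca.
Qed.

Lemma split_b_Cb : b \in Cb.
Proof.
have [_ bH _] := split_ends; case: ok => _ _ _ h _; apply/(proj2 (h b)).
by apply: reach_refl; rewrite // inE eq_sym split_cb.
Qed.

Lemma split_Ca x : x \in Ca <-> reach H [:: c] [:: e.1] a x.
Proof. by case: ok => _ _ _ h _; case: (h x). Qed.

Lemma split_Cb x : x \in Cb <-> reach H [:: c] [:: e.1] b x.
Proof. by case: ok => _ _ _ h _; case: (h x). Qed.

Lemma split_inV x : (x \in Ca) || (x \in Cb) -> x \in gV H /\ x != c.
Proof.
by case/orP => [/split_Ca|/split_Cb] /reach_in [? ]; rewrite inE.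
Qed.

(** Biconnectedness gives a path from [a] to [x] that avoids [c]. Its steps stay in a component of
    [H - e - c], except along [e], which only moves between [a] and [b]. *)
Lemma split_cover x : x \in gV H -> x != c -> (x \in Ca) || (x \in Cb).
Proof.
move=> xH xc; have [aH bH nab] := split_ends.
have [[[_ bic] _ cH _ _] _ _ _ _] := ok.
have : reach H [:: c] [::] a x.
  have ac : a != c by rewrite eq_sym split_ca.
  by case: (eqVneq a x) => [<-|nax]; [apply: reach_refl; rewrite // inE | apply: bic].
case=> _ _ [p [pp <-]].
suff main z : path (adj H [:: c] [::]) z p -> (z \in Ca) || (z \in Cb) ->
    (last z p \in Ca) || (last z p \in Cb).
  by apply: main pp _; rewrite split_a_Ca.
elim: p z {pp} => [//|y p IH] z /= /andP[adjzy pp] zC; apply: IH => //.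
case/and5P: (adjzy) => zH yH zc yc /hasP[g gH /= ge].
case: (eqVneq g.1 e.1) => [gl|gl].
  case/orP: (split_ends_or gH gl ge) => /andP[_ /eqP ->]; first by rewrite split_b_Cb orbT.
  by rewrite split_a_Ca.
have adj' : adj H [:: c] [:: e.1] z y.
  by apply/and5P; split=> //; apply/hasP; exists g; rewrite // inE gl.
by case/orP: zC => [/split_Ca|/split_Cb] h; apply/orP;
   [left; apply/split_Ca | right; apply/split_Cb]; apply: reach_trans h (reach_adj adj').
Qed.

(** A common vertex would make all of [H - e - c] reachable from [a], against the separated pair
    provided by [vesep]. *)
Lemma split_disjoint x : x \in Ca -> x \in Cb -> False.
Proof.
move=> /split_Ca ax /split_Cb bx.
have ab : reach H [:: c] [:: e.1] a b by apply: reach_trans ax (reach_sym bx).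
have all_ z : z \in gV H -> z != c -> reach H [:: c] [:: e.1] a z.
  move=> zH zc; case/orP: (split_cover zH zc) => [/split_Ca//|/split_Cb bz].
  exact: reach_trans ab bz.
have [[_ _ _ _ [y [z [yH zH yc zc nr]]]] _ _ _ _] := ok; apply: nr.
exact: reach_trans (reach_sym (all_ _ yH yc)) (all_ _ zH zc).
Qed.

Let wa (g : nat * (nat * nat)) := (g.2.1 \in c :: Ca) && (g.2.2 \in c :: Ca).
Let wb (g : nat * (nat * nat)) := (g.2.1 \in c :: Cb) && (g.2.2 \in c :: Cb).

(** An edge other than [e] that avoids [c] stays in one component. The two sides share only the
    vertex [c], so, without loops, no edge lies in both. The edge [e] joins the components and lies
    in neither. *)
Lemma split_edge_sides g : g \in gE H ->
  [/\ g == e -> ~~ wa g /\ ~~ wb g, ~~ (wa g && wb g) & [|| wa g, wb g | g == e]].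
Proof.
move=> gH; have [g1 g2 ne] := realises_edge rH gH.
have nC x : x \in Ca -> x \in Cb = false.
  by move=> xA; apply/negP => /(split_disjoint xA).
split.
- move=> /eqP ->; rewrite /wa /wb.
  have aB := nC _ split_a_Ca.
  have bA : b \in Ca = false by apply/negP => /split_disjoint/(_ split_b_Cb).
  have ca := negbTE split_ca; have cb := negbTE split_cb.
  case: ok => _ + _ _ _; case: (e.2) => u v /=.
  by case/orP=> /andP[/eqP <- /eqP <-];
     rewrite !in_cons aB bA ![_ == c]eq_sym ca cb ?andbF.
- apply/negP => /andP[/andP[a1 a2] /andP[b1 b2]].
  have both x : x \in c :: Ca -> x \in c :: Cb -> x = c.
    by rewrite !in_cons => /predU1P[//|xA] /predU1P[//|/(split_disjoint xA)].
  by move: ne; rewrite (both _ a1 b1) (both _ a2 b2) eqxx.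
have cov x : x \in gV H -> [|| x == c, x \in Ca | x \in Cb].
  by move=> xH; case: (eqVneq x c) => //= /(split_cover xH).
case: (eqVneq g e) => [|nge]; first by rewrite !orbT.
have gl : g.1 != e.1.
  apply: contra nge => /eqP gl; have [uH _ _ _] := rH.
  by apply/eqP; apply: (label_inj uH) => //; apply: split_edge.
have tr x y : adj H [:: c] [:: e.1] x y -> (x \in Ca -> y \in Ca) /\ (x \in Cb -> y \in Cb).
  move=> /reach_adj xy; split.
    by move=> /split_Ca h; apply/split_Ca; apply: reach_trans h xy.
  by move=> /split_Cb h; apply/split_Cb; apply: reach_trans h xy.
rewrite orbF /wa /wb !in_cons; move: (cov _ g1) (cov _ g2).
case: (eqVneq g.2.1 c) => [->|n1] /=.
  by move=> _; case: (g.2.2 == c).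
case: (eqVneq g.2.2 c) => [->|n2] /=; first by rewrite !andbT => ->.
have ad : adj H [:: c] [:: e.1] g.2.1 g.2.2.
  apply/and5P; split; rewrite ?inE //; apply/hasP; exists g; rewrite // inE gl /=.
  by rewrite -surjective_pairing eqxx.
have [t1 t2] := tr _ _ ad.
by case/orP=> [x1|x1] _; [rewrite x1 t1 | rewrite x1 t2 ?orbT].
Qed.

Lemma split_perm : perm_eq (gE H) (filter wa (gE H) ++ rcons (filter wb (gE H)) e).
Proof.
have uE : uniq (gE H) by have [uH _ _ _] := rH; apply: map_uniq uH.
apply: uniq_perm => //.
  rewrite cat_uniq filter_uniq // rcons_uniq filter_uniq // andbT /=.
  have [/(_ (eqxx _))[na nb] _ _] := split_edge_sides split_edge.
  rewrite mem_filter (negbTE nb) andbT; apply/hasPn => g.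
  rewrite mem_rcons in_cons !mem_filter => /predU1P[->|/andP[wg gH]].
    by rewrite (negbTE na).
  have [_ nab _] := split_edge_sides gH.
  by move: nab; rewrite wg andbT => /negbTE ->.
move=> g; rewrite mem_cat mem_rcons in_cons !mem_filter.
case gH: (g \in gE H).
  have [_ _] := split_edge_sides gH.
  by rewrite !andbT => /or3P[] ->; rewrite ?orbT.
by rewrite !andbF orbF /=; case: eqP gH => // ->; rewrite split_edge.
Qed.

Let A := map elabel (filter wa (gE H)).
Let B := rcons (map elabel (filter wb (gE H))) e.1.

(** [e] lies in neither induced subgraph, but [Q] adds it again under its old label; hence [B] ends
    with [e.1], and [f] is the only new label. *)
Lemma split_labels :
  [/\ labels P = rcons A f, labels Q = rcons B f & perm_eq (labels H) (A ++ B)].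
Proof.
split; rewrite /labels /= ?map_rcons //.
by have := perm_map elabel split_perm; rewrite map_cat map_rcons.
Qed.

Lemma split_uniq : uniq (f :: A ++ B).
Proof.
have [_ _ pH] := split_labels; have [uH _ _ _] := rH.
by rewrite /= -(perm_mem pH) -(perm_uniq pH) fH uH.
Qed.

Lemma split_uniqs : [/\ uniq (labels P), uniq (labels Q) & forall l, l \in A -> l \in B -> False].
Proof.
have [-> -> _] := split_labels; have [_ u1 u2 _ _] := twosum_uniq split_uniq.
split=> [||l]; rewrite ?(rcons_uniq A) ?(rcons_uniq B) //.
by move=> lA lB; apply: (twosum_disjoint split_uniq lA lB).
Qed.

Lemma split_incf x : inc E f x = (x == a) || (x == c).
Proof. by rewrite /inc Ef. Qed.

Lemma split_ince x : inc E e.1 x = (x == a) || (x == b).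
Proof.
have [_ _ hH _] := rH; rewrite hH ?split_edge //.
by case: ok => _ /orP[] /andP[/eqP -> /eqP ->] _ _ _; rewrite // orbC.
Qed.

Lemma split_realises : realises E P /\ realises E Q.
Proof.
have [uP uQ _] := split_uniqs; have [_ lH hH vH] := rH.
have [eP eQ pH] := split_labels.
have lA l : l \in A ++ B -> (E l).1 != (E l).2 by rewrite -(perm_mem pH); apply: lH.
have lf : (E f).1 != (E f).2 by rewrite Ef /= eq_sym split_ca.
have ea := split_a_Ca; have eb := split_b_Cb.
split; split=> //.
- move=> l; rewrite eP mem_rcons in_cons => /predU1P[->//|l1].
  by apply: lA; rewrite mem_cat l1.
- move=> g; rewrite /= mem_rcons in_cons mem_filter => /predU1P[->|/andP[_ gH]] x.
    exact: split_incf.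
  exact: hH.
- move=> l x; rewrite eP mem_rcons in_cons => /predU1P[->|/mapP[g]].
    by rewrite split_incf /= in_cons => /orP[] /eqP ->; rewrite ?eqxx // ea orbT.
  by rewrite mem_filter => /andP[/andP[g1 g2] gH] ->; rewrite hH // => /orP[] /eqP ->.
- move=> l; rewrite eQ mem_rcons in_cons => /predU1P[->//|l1].
  by apply: lA; rewrite mem_cat l1 orbT.
- move=> g; rewrite /= !(mem_rcons, in_cons) mem_filter => /or3P[/eqP->|/eqP->|/andP[_ gH]] x.
  + exact: split_incf.
  + by rewrite split_ince /= orbC.
  + exact: hH.
- move=> l x; rewrite eQ !(mem_rcons, in_cons) => /or3P[/eqP->|/eqP->|/mapP[g]].
  + by rewrite split_incf /= => /orP[] /eqP ->; rewrite eqxx ?orbT.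
  + by rewrite split_ince /= => /orP[] /eqP ->; rewrite ?eqxx ?eb ?orbT.
  + rewrite mem_filter => /andP[/andP[g1 g2] gH] ->; rewrite hH //.
    by rewrite /wb !in_cons in g1 g2; case/orP=> /eqP ->; rewrite ?g1 ?g2 orbT.
Qed.

(** In [Q] the vertex [a] is added from outside [c :: Cb], so only the two added edges [e] and [f]
    meet it. *)
Lemma split_twosum : is_twosum E f H P Q.
Proof.
have [uP uQ dAB] := split_uniqs; have [eP eQ pH] := split_labels.
have [_ _ hH _] := rH.
have [_ /andP[fA _] /andP[fB uB] _ _] := twosum_uniq split_uniq.
exists A, B, a, c, e.1; split.
- by rewrite eP eQ !perm_rcons !perm_refl.
- rewrite /meet eP eQ !mem_rcons !mem_head; split=> //.
    move=> g; rewrite mem_rcons in_cons => /predU1P[//|gA].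
    by rewrite mem_rcons in_cons => /predU1P[//|gB]; case: (dAB _ gA gB).
  move=> x; rewrite split_incf /= !in_cons => /predU1P[->|xA]; first by rewrite eqxx orbT.
  by case/or3P=> [->//|->|/(split_disjoint xA)//]; rewrite orbT.
- by rewrite eq_sym split_ca; split=> // x; rewrite split_incf.
split; first by rewrite mem_rcons mem_head.
move=> l; rewrite mem_rcons in_cons => /predU1P[->|lB].
  by rewrite split_ince !eqxx.
have eB : e.1 \notin map elabel (filter wb (gE H)).
  by have : uniq B := uB; rewrite rcons_uniq => /andP[].
have -> : (l == e.1) = false by apply/negbTE; apply: contraNneq eB => <-.
case/mapP: lB => g; rewrite mem_filter => /andP[/andP[g1 g2] gH] ->.
have aN : a \notin c :: Cb.
  rewrite in_cons eq_sym (negbTE split_ca) /=.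
  by apply/negP; apply: split_disjoint split_a_Ca.
rewrite hH //; apply/negbTE; rewrite negb_or.
by apply/andP; split; apply: contraNneq aN => ->.
Qed.

Lemma split_verts x : (x \in gV P) || (x \in gV Q) = (x \in gV H).
Proof.
have [[_ _ cH _ _] _ _ _ _] := ok; have [aH _ _] := split_ends.
rewrite /= !in_cons; case: (eqVneq x c) => [->|xc] //=.
case: (eqVneq x a) => [->|xa] /=; first by rewrite aH orbT.
apply/idP/idP => [/split_inV[]//|xH].
exact: split_cover.
Qed.

End Split.

Lemma good_split_step E s t : split_step s t -> good E s ->
  exists E', [/\ good E' t, excess cmin s t & excess numax s t].
Proof.
case=> {s t} s1 H s2 c e a b Ca Cb f ok fs gs.
(* [E] may already have some value at [f]; overwriting it is harmless, as no current piece carries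
   this label. *)
pose E' l := if l == f then (a, c) else E l.
have EE : {in all_labels (s1 ++ H :: s2), E =1 E'}.
  by move=> l; rewrite /E'; case: eqP fs => // -> /negbTE ->.
have pH (T : seq mgraph) : perm_eq (s1 ++ T ++ s2) (T ++ s1 ++ s2) by rewrite perm_catCA.
have gs' := good_perm (pH [:: H]) (good_eq EE gs).
have fs' : f \notin all_labels (H :: s1 ++ s2).
  by rewrite -(perm_mem (perm_all_labels (pH [:: H]))).
have [rH _] : realises E' H /\ exists n, dec E' (labels H) n.
  by case: gs' => h _ _; apply: h; rewrite mem_head.
have fH : f \notin labels H.
  by apply: contra fs' => fH; apply/all_labelsP; exists H; rewrite ?mem_head.
have Ef : E' f = (a, c) by rewrite /E' eqxx.
have [rP rQ] := split_realises rH ok fH Ef.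
have [g c1 c2] := good_split gs' rP rQ (split_twosum rH ok fH Ef) fs' (split_verts f rH ok).
exists E'; split.
- by apply: good_perm g; rewrite perm_sym; apply: (pH [:: _; _]).
- by apply: excess_perm c1; rewrite perm_sym; [apply: (pH [:: _]) | apply: (pH [:: _; _])].
- by apply: excess_perm c2; rewrite perm_sym; [apply: (pH [:: _]) | apply: (pH [:: _; _])].
Qed.

(** * A merge as a 2-sum *)

Lemma labels_glue P Q f : labels (glue P Q f) =
  filter (predC1 f) (labels P) ++ filter (predC1 f) (labels Q).
Proof.
by rewrite /labels /= -filter_cat -map_cat filter_map.
Qed.

(** On a cycle every vertex has degree two. The witnesses are the vertex where [f] arrives, the one
    it leaves, and the next edge, distinct from [f] since the length is at least two. *)
Lemma cycle_degree2 E Q f : realises E Q -> is_cycle Q [set: _] -> f \in labels Q ->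
  exists a c e, [/\ a != c, forall x, inc E f x = (x == a) || (x == c),
    e \in labels Q, e != f & {in labels Q, forall l, l != f -> inc E l a = (l == e)}].
Proof.
move=> rQ cQ fQ; have [uQ lQ _ _] := rQ.
have ci : circuit E (labels Q) predT.
  apply/(is_cycleE _ rQ); have -> // : [set i | predT (nth 0 (labels Q) (val i))] =
    [set: 'I_(size (gE Q))].
  by apply/setP=> i; rewrite !inE.
have [vs [ls [[s2 sv uv ul h] sub el]]] := circuit_cyclic_walk uQ lQ ci.
have /(nthP 0)[i ilt ei] : f \in ls by rewrite -el.
set n := size ls in s2 sv h ilt.
have jn : i.+1 %% n < n by rewrite ltn_mod; lia.
have nij : i.+1 %% n != i.
  case: (ltngtP i.+1 n) => c; try lia; first by rewrite modn_small //; lia.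
  by rewrite c modnn; lia.
exists (nth 0 vs (i.+1 %% n)), (nth 0 vs i), (nth 0 ls (i.+1 %% n)); split.
- by rewrite nth_uniq ?sv.
- by move=> x; rewrite -ei h // orbC.
- by apply: sub; apply: mem_nth.
- by rewrite -ei nth_uniq.
move=> l lL; have /(nthP 0)[k kn <-] : l \in ls by rewrite -el.
rewrite -ei nth_uniq // => nki; rewrite h // !nth_uniq ?sv //; last by rewrite ltn_mod; lia.
rewrite [LHS]orbC eq_sym [X in _ || X]eq_sym.
have -> // : (k.+1 %% n == i.+1 %% n) = false.
apply/negbTE; apply: contra nki; rewrite -/n in kn.
case: (ltngtP i.+1 n) => c1; case: (ltngtP k.+1 n) => c2;
  rewrite ?c1 ?c2 ?modnn ?(modn_small c1) ?(modn_small c2) //; lia.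
Qed.

(** A merge is a 2-sum read from the summands to the whole; the cycle [Q] supplies the end of [f] of
    degree two. *)
Lemma good_merge E P Q rest f : good E (P :: Q :: rest) -> mergeable P Q f ->
  [/\ good E (glue P Q f :: rest),
      excess cmin (P :: Q :: rest) (glue P Q f :: rest) &
      excess numax (P :: Q :: rest) (glue P Q f :: rest)].
Proof.
move=> gs [_ [cQ _] fP fQ]; have [h1 h2 h3] := gs.
have [rP [n1 d1]] := h1 P (mem_head _ _).
have [rQ [n2 d2]] : realises E Q /\ exists n, dec E (labels Q) n.
  by apply: h1; rewrite !in_cons eqxx orbT.
set R := glue P Q f; have eR : labels R = _ := labels_glue P Q f.
have hlR g : (g \in labels R) = (g != f) && ((g \in labels P) || (g \in labels Q)).
  by rewrite eR mem_cat !mem_filter /=; case: (g != f).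
have hvR x : (x \in gV R) = (x \in gV P) || (x \in gV Q).
  by rewrite /R /= mem_undup mem_cat.
(* The tree order also yields that [P] and [Q] share nothing but [f] and its ends, so the labels of
   [R] are unique and the gluing is a 2-sum. *)
have [mE tl] := treelike_merge h2 (good_ends_inside gs) h3 (perm_refl _) fP fQ hlR hvR.
have [_ _ hl hv] := mE.
have [uP lP hP vP] := rP; have [uQ lQ hQ vQ] := rQ.
have rR : realises E R.
  split.
  - rewrite eR cat_uniq !filter_uniq // andbT; apply/hasPn => l; rewrite !mem_filter /=.
    case/andP=> lf lQ'; apply/negP => /andP[_ lP'].
    by move: lf; rewrite (hl l) ?eqxx.
  - by move=> l; rewrite hlR => /andP[_ /orP[]]; [apply: lP | apply: lQ].
  - by move=> g; rewrite mem_filter mem_cat => /andP[_ /orP[]]; [apply: hP | apply: hQ].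
  - move=> l x; rewrite hlR hvR => /andP[_ /orP[lL|lL] lx].
      by rewrite (vP l).
    by rewrite (vQ l) ?orbT.
have perm_f (K : mgraph) : uniq (labels K) -> f \in labels K ->
    perm_eq (labels K) (f :: filter (predC1 f) (labels K)).
  by move=> uK fK; rewrite -rem_filter //; apply: perm_to_rem.
have ts : is_twosum E f R P Q.
  have [a [c [e [nac incf eQ nef deg2]]]] := cycle_degree2 rQ cQ fQ.
  exists (filter (predC1 f) (labels P)), (filter (predC1 f) (labels Q)), a, c, e.
  split=> //; first by rewrite eR; split; rewrite ?perm_f ?perm_refl.
  split; first by rewrite mem_filter /= nef.
  by move=> l; rewrite mem_filter => /andP[/= nlf lQ']; apply: deg2.
have [_ jn] := twosum_dec rR rP rQ ts.
have [n dn _] := jn _ _ d1 d2.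
have [e1 e2] := twosum_cmin_numax rR rP rQ ts (ex_intro _ n dn).
split; last 2 first.
- by rewrite /excess !big_cons /=; lia.
- by rewrite /excess !big_cons /=; lia.
split=> //.
- move=> K; rewrite in_cons => /predU1P[->|Ks]; first by split=> //; exists n.
  by apply: h1; rewrite !in_cons Ks !orbT.
- move=> g; apply: leq_trans (h2 g).
  rewrite -(cat1s P) -(cat1s Q) -(cat1s R) !all_labels_cat !all_labels1 eR.
  rewrite !count_cat addnA leq_add2r.
  by apply: leq_add; apply: leq_count_subseq; apply: filter_subseq.
Qed.

Lemma good_merge_step E s t : merge_step s t -> good E s ->
  [/\ good E t, excess cmin s t & excess numax s t].
Proof.
case=> {s t} s1 P s2 Q s3 f mg gs.
have p1 : perm_eq (s1 ++ P :: s2 ++ Q :: s3) (P :: Q :: s1 ++ s2 ++ s3).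
  rewrite (perm_catCA s1 [:: P]) /= perm_cons.
  by rewrite catA (perm_catCA (s1 ++ s2) [:: Q]) /= -catA.
have p2 : perm_eq (s1 ++ glue P Q f :: s2 ++ s3) (glue P Q f :: s1 ++ s2 ++ s3).
  by rewrite (perm_catCA s1 [:: _]).
have [g c1 c2] := good_merge (good_perm p1 gs) mg.
split.
- by apply: good_perm g; rewrite perm_sym.
- by apply: excess_perm c1; rewrite perm_sym.
- by apply: excess_perm c2; rewrite perm_sym.
Qed.

Lemma excess_trans F s t u : excess F s t -> excess F t u -> excess F s u.
Proof. by rewrite /excess; lia. Qed.

Theorem theorem10 (G : mgraph) (comps : seq mgraph) :
  wf G -> biconnected G -> eulerian G ->
  two_half_components G comps ->
  cmin G + size comps = \sum_(H <- comps) cmin H + 1 /\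
  numax G + size comps = \sum_(H <- comps) numax H + 1.
Proof.
move=> wG _ eG [t [st _ mt _]].
have [E rG] := wf_realises wG.
have g0 : good E [:: G].
  split.
  - by move=> H; rewrite inE => /eqP ->; split=> //; apply: eulerian_dec.
  - move=> g; rewrite all_labels1; have [uG _ _ _] := rG.
    by rewrite count_uniq_mem //; case: (g \in _).
  - by exists [:: G] => //; split=> //; left.
(* Each split may change the incidence map at its new label, so the map is quantified along the
   splits; merges keep it fixed. *)
have [E1 [g1 c1 n1]] : exists E1, [/\ good E1 t, excess cmin [:: G] t & excess numax [:: G] t].
  elim: st E g0 {rG} => {t mt} [s|s t u st _ IH] E gs.
    by exists E; split.
  have [E' [gt ct nt]] := good_split_step st gs.
  have [E1 [gu cu nu]] := IH E' gt.
  by exists E1; split=> //; apply: excess_trans; eassumption.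
have [c2 n2] : excess cmin t comps /\ excess numax t comps.
  elim: mt g1 => {c1 n1 st} [s|s u v su _ IH] gs; first by split.
  have [gu cu nu] := good_merge_step su gs; have [cv nv] := IH gu.
  by split; apply: excess_trans; eassumption.
(* The starting list [[:: G]] has length one, which is the constant 1 of the formula. *)
have := excess_trans c1 c2; have := excess_trans n1 n2.
by rewrite /excess !big_seq1 /=; lia.
Qed.
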